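(* Assume that $f$ is continuously differentiable on $\mathcal{I}_-=(0,1)$ and $\inf_{x\in\mathcal{I}} f(x)>0$, where $\mathcal{I}=[0,1]$. For each $n$, let $\widetilde{w}_1,\ldots,\widetilde{w}_n$ be weight functions on $\mathcal{I}$ that depend solely on $X_1,\ldots,X_n$ and satisfy $\sum_{j=1}^n \widetilde{w}_j(x)=1$ for all $x$, and define the updated weight functions $$\hat{w}_j(x)=w_j(x)+\widetilde{w}_j(x)-\sum_{i=1}^n w_i(x)\,\widetilde{w}_j(X_i),\qquad j=1,\ldots,n,$$ where $w_i(x)=K_h(X_i-x)/\sum_{k=1}^n K_h(X_k-x)$ are the Nadaraya--Watson weights. Let $r\ge1$ be an integer. Suppose that $$\sum_{j=1}^n\widetilde{w}_j(x)[m(X_j)-m(x)]=h^{2r}\alpha_n(x)+O_p\left(\sqrt{\frac{h\log n}{n}}\right)$$ uniformly for $x\in\mathcal{I}_\varepsilon$ for arbitrarily small $\varepsilon>0$, where $\alpha_n$ is a (deterministic) sequence of functions that are twice differentiable on $\mathcal{I}_-$ and satisfy $$\lim_{\delta\to0}\limsup_{n\to\infty}\sup_{|u-v|\le\delta}\left|\alpha_n^{(k)}(u)-\alpha_n^{(k)}(v)\right|=0$$ for $k=0,1,2$ (the supremum being over $u,v\in\mathcal{I}_-$). Then $$\sum_{j=1}^n\hat{w}_j(x)[m(X_j)-m(x)]=h^{2(r+1)}\beta_n(x)+O_p\left(\sqrt{\frac{h\log n}{n}}\right)$$ uniformly for $x\in\mathcal{I}_\varepsilon$ for arbitrarily small $\varepsilon>0$,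 where $\beta_n$ is a deterministic sequence of functions such that, for each $x\in\mathcal{I}_-$, $$\beta_n(x)=-\frac12\left[\frac{\alpha_n''(x)f(x)+2\alpha_n'(x)f'(x)}{f(x)}\right]\int u^2K(u)\,du+o(1)\quad\text{as } n\to\infty.$$
   Context: $(X_1,Y_1),\ldots,(X_n,Y_n)$ are independent and identically distributed copies of a pair $(X,Y)$ of real random variables; $X$ has marginal density $f$ supported on $\mathcal{I}=[0,1]$, and $m(x)=E(Y|X=x)$ is the regression function. The kernel $K$ is a symmetric probability density function which is Lipschitz continuous and supported on $[-1,1]$. The bandwidth $h=h_n>0$ is a deterministic sequence with $h\to0$ and $nh/\log n\to\infty$ as $n\to\infty$, and $K_h(u)=K(u/h)/h$. For $\varepsilon>0$, $\mathcal{I}_\varepsilon=[\varepsilon,1-\varepsilon]$. A statement ''uniformly for $x\in\mathcal{I}_\varepsilon$ for arbitrarily small $\varepsilon>0$'' means that for every sufficiently small fixed $\varepsilon>0$ the supremum over $x\in\mathcal{I}_\varepsilon$ of the absolute value of the remainder is of the stated $O_p$ order as $n\to\infty$. Interpretation: a pre-estimate $\widetilde{m}(x)=\sum_j\widetilde{w}_j(x)Y_j$ of $m$ is updated by one step of $L_2$ boosting, $\hat{m}(x)=\widetilde{m}(x)+\sum_{i=1}^n w_i(x)[Y_i-\widetilde{m}(X_i)]=\sum_{j=1}^n\hat{w}_j(x)Y_j$; the sums $\sum_j\widetilde{w}_j(x)[m(X_j)-m(x)]$ and $\sum_j\hat{w}_j(x)[m(X_j)-m(x)]$ are the conditional biases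 of $\widetilde{m}(x)$ and $\hat{m}(x)$ given $X_1,\ldots,X_n$. *)

(* Defs.v *)
From HB Require Import structures.
From mathcomp Require Import all_boot all_order all_algebra.
From mathcomp Require Import all_classical all_reals all_analysis.

Set Implicit Arguments.
Unset Strict Implicit.
Unset Printing Implicit Defensive.

Import Order.TTheory GRing.Theory Num.Theory.
Import numFieldNormedType.Exports.

Local Open Scope classical_set_scope.
Local Open Scope ring_scope.

Section sampling.
Context d (T : measurableType d) (R : realType) (P : probability T R).

Definition mutually_independent d' (S : measurableType d')
    (Z : nat -> T -> S) : Prop :=
  forall (J : seq nat) (B : nat -> set S),
    uniq J -> (forall i, measurable (B i)) ->
    P [set w | forall i, i \in J -> B i (Z i w)] =
    (\prod_(i <- J) P (Z i @^-1` B i))%E.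

Definition same_law d' (S : measurableType d') (Z Z' : T -> S) : Prop :=
  forall B : set S, measurable B -> P (Z @^-1` B) = P (Z' @^-1` B).

Definition iid_copies (Xs Ys : nat -> {RV P >-> R}) (X Y : {RV P >-> R}) :
    Prop :=
  mutually_independent (fun i w => (Xs i w, Ys i w)) /\
  forall i, same_law (fun w => (Xs i w, Ys i w)) (fun w => (X w, Y w)).

Definition has_density (X : {RV P >-> R}) (f : R -> R) : Prop :=
  [/\ measurable_fun setT f, forall x, 0 <= f x &
      forall B : set R, measurable B ->
        P (X @^-1` B) = (\int[lebesgue_measure]_(x in B) (f x)%:E)%E].

(* [m] is a version of the conditional expectation [E(Y | X = x)]. *)
Definition regression_function (X Y : {RV P >-> R}) (m : R -> R) : Prop :=
  [/\ P.-integrable setT (EFin \o Y),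
      measurable_fun setT m,
      P.-integrable setT (EFin \o (m \o X)) &
      forall B : set R, measurable B ->
        (\int[P]_(w in X @^-1` B) (Y w)%:E =
         \int[P]_(w in X @^-1` B) (m (X w))%:E)%E].

(* [Z n = O_p(a n)]. The outer measure [P^*] is used because a supremum over
   uncountably many points need not be measurable; [P^*] is [P] on events. *)
Definition bigO_p (Z : nat -> T -> \bar R) (a : nat -> R) : Prop :=
  forall eta : R, 0 < eta -> exists2 M : R, 0 < M &
    \forall n \near \oo,
      ((P^*)%mu [set w | (M * a n)%:E < Z n w] <= eta%:E)%E.

Definition bigO_p_interior (D : nat -> T -> R -> R) (a : nat -> R) : Prop :=
  \forall eps \near 0^'+,
    bigO_p (fun n w =>
      ereal_sup [set `|D n w x|%:E | x in `[eps, 1 - eps]]) a.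

Definition design (Xs : nat -> {RV P >-> R}) n (w : T) : 'I_n -> R :=
  fun i => Xs i w.

End sampling.

Section weights.
Context (R : realType).

Definition kernel_function (K : R -> R) : Prop :=
  [/\ forall u, 0 <= K u,
      (\int[lebesgue_measure]_u (K u)%:E = 1)%E,
      forall u, K (- u) = K u,
      lipschitz K &
      forall u, 1 < `|u| -> K u = 0].

Definition rescaled (K : R -> R) (h : R) : R -> R := fun u => K (u / h) / h.

(* Below, [t : 'I_n -> R] is a design sample; all the weights are functions of
   [t]. [nw_weight] is [0] when the denominator vanishes. *)
Definition nw_weight (K : R -> R) (h : R) n (t : 'I_n -> R) (i : 'I_n)
    (x : R) : R :=
  rescaled K h (t i - x) / \sum_(k < n) rescaled K h (t k - x).

Definition boosted_weight (K : R -> R) (h : R) n (t : 'I_n -> R)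
    (wt : 'I_n -> R -> R) (j : 'I_n) (x : R) : R :=
  nw_weight K h t j x + wt j x - \sum_(i < n) nw_weight K h t i x * wt j (t i).

Definition cond_bias (m : R -> R) n (t : 'I_n -> R) (w : 'I_n -> R -> R)
    (x : R) : R :=
  \sum_(j < n) w j x * (m (t j) - m x).

Definition asymptotically_equicontinuous (A : set R) (g : nat -> R -> R) :
    Prop :=
  limn_esup (fun n => ereal_sup
    [set `|g n uv.1 - g n uv.2|%:E |
     uv in [set uv : R * R | [/\ A uv.1, A uv.2 & `|uv.1 - uv.2| <= delta]]])
  @[delta --> 0^'+] --> 0%E.

End weights.

(* Main.v *)
Require Import Defs.
From HB Require Import structures.
From mathcomp Require Import all_boot all_order all_algebra.
From mathcomp Require Import all_classical all_reals all_analysis.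
From mathcomp Require Import measurable_realfun ring lra.

Import Order.TTheory GRing.Theory Num.Theory.
Import numFieldNormedType.Exports.

Set Implicit Arguments.
Unset Strict Implicit.
Unset Printing Implicit Defensive.

Local Open Scope classical_set_scope.
Local Open Scope ring_scope.

(** Write B(x) for the conditional bias of the pre-estimate and w_i(x) for the
    Nadaraya-Watson weights.  Because the weights of the pre-estimate sum to
    one, subtracting the smoothed residuals turns the bias of the boosted
    estimate into the difference B(x) - sum_i w_i(x) B(X_i)
    [cond_bias_boosted].  Smoothing is a contraction for the supremum norm and
    only looks at distance h, so the remainder of B survives with at most twice
    its size, and the leading term becomes - h^(2r) times the bias of the
    Nadaraya-Watson smoother applied to the noiseless data (X_i, alpha_n(X_i)).

    That bias has a deterministic counterpart, the ratio of integrals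
    [nw_bias], and beta_n is defined as - [nw_bias] / h^2.  Two facts remain.

    1. Replacing the bias by its counterpart costs O_p (sqrt (h log n / n)),
       uniformly in x [nw_smoother_deviation].  Numerator and denominator of
       the smoother are averages of functions of X_i which are bounded, have
       second moment of order h and depend on x in a Lipschitz way, the
       Lipschitz constant being polynomial in n.  For such families an
       exponential Markov inequality tilted by sqrt (log n / (n h)) gives
       pointwise deviation probabilities of order n^(-4), which a union over a
       grid of n^3 + 1 points turns into a uniform bound [uniform_deviation].
       Since alpha_n(X_i) - alpha_n(x) is O(h) wherever the kernel is nonzero,
       the numerator fluctuates less than the denominator by a factor h.

    2. At every x, - [nw_bias] / h^2 differs by o(1) from the second order
       expression of the statement [nw_bias_asymptotics].  A second order Taylor expansion of
       alpha_n times a first order expansion of f is integrated against the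
       symmetric kernel [kernel_integral_approx]; the error is uniform in n by
       the equicontinuity of alpha_n''.  Equicontinuity alone does not bound the
       derivatives, but combined with the equicontinuity of the function
       differentiated it does [derive_bounded_near].

    The expectation of a product of functions of independent variables is
    derived from the product rule for events [expectation_prod_indep]. *)

(** * Integration against a density, and products of independent variables *)

Section density.
Context d d' (T : measurableType d) (T' : measurableType d') (R : realType).
Variables (mu : {measure set T -> \bar R}) (nu : {measure set T' -> \bar R}).
Variables (X : T -> T') (Z : T -> R).
Hypotheses (mX : measurable_fun setT X) (mZ : measurable_fun setT Z).
Hypotheses (Z0 : forall w, 0 <= Z w).
Hypothesis nuE : forall B, measurable B ->
  nu B = (\int[mu]_(w in X @^-1` B) (Z w)%:E)%E.

Import HBNNSimple.

Let nnsfun_density (g : {nnsfun T' >-> R}) :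
  (\int[nu]_y (g y)%:E = \int[mu]_w (g (X w) * Z w)%:E)%E.
Proof.
have mpre y : measurable (X @^-1` (g @^-1` [set y])).
  rewrite -[X in measurable X]setTI; apply: mX => //.
have mind y : measurable_fun setT ((\1_(g @^-1` [set y]) : T' -> R) \o X).
  by apply: measurableT_comp.
rewrite integralT_nnsfun sintegralE.
transitivity (\int[mu]_w
   (\sum_(y \in range g) (y * \1_(g @^-1` [set y]) (X w) * Z w)%:E))%E; last first.
  apply: eq_integral => w _; rewrite /= fimfunE fsumEFin//; congr EFin.
  by rewrite !fsbig_finite//= big_distrl.
rewrite ge0_integral_fsum//; last 2 first.
  - move=> y; apply/measurable_EFinP; apply: measurable_funM => //.
    by apply: measurable_funM => //; exact: mind.
  - move=> y w _; rewrite lee_fin mulr_ge0//.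
    by rewrite -lee_fin EFinM nnfun_muleindic_ge0.
apply: eq_fsbigr => y /[!inE] -[x _ gxy].
under eq_integral do rewrite -mulrA EFinM.
rewrite ge0_integralZl//=; last 3 first.
- by apply/measurable_EFinP/measurable_funM => //; exact: mind.
- by move=> w _; rewrite lee_fin mulr_ge0// indicE.
- by rewrite -gxy lee_fin.
rewrite nuE//; congr (_ * _)%E.
rewrite integral_mkcond; apply: eq_integral => w _; rewrite epatch_indic/=.
by rewrite -EFinM mulrC.
Qed.

(** The hypothesis on [nu] is the conclusion for indicators.  Besides its use for
    the density of the design, where [X] is the identity, it lets one factor of
    a product of independent variables vary while the others form the density
    [Z]. *)
Lemma ge0_integral_density (phi : T' -> R) :
  measurable_fun setT phi -> (forall y, 0 <= phi y) ->
  (\int[nu]_y (phi y)%:E = \int[mu]_w (phi (X w) * Z w)%:E)%E.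
Proof.
move=> mphi phi0.
have mEphi : measurable_fun setT (EFin \o phi) by exact/measurable_EFinP.
pose g := nnsfun_approx measurableT mEphi.
have gphi y : (g n y)%:E @[n --> \oo] --> (phi y)%:E.
  by apply: (@cvg_nnsfun_approx _ _ _ _ measurableT _ mEphi) => //= x _; rewrite lee_fin.
have gnd y a b : (a <= b)%N -> g a y <= g b y.
  by move=> ab; exact/lefP/nd_nnsfun_approx.
transitivity (limn (fun n => \int[nu]_y (g n y)%:E)%E).
  rewrite -monotone_convergence//=.
  - by apply: eq_integral => y _; apply/esym/cvg_lim.
  - by move=> n; apply/measurable_EFinP.
  - by move=> n y _; rewrite lee_fin.
  - by move=> y _ a b ab; rewrite lee_fin gnd.
under eq_fun do rewrite nnsfun_density.
rewrite -monotone_convergence//=.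
- apply: eq_integral => w _; apply/cvg_lim => //.
  under eq_fun do rewrite EFinM; rewrite EFinM.
  by apply: cvgeZr.
- move=> n; apply/measurable_EFinP/measurable_funM => //.
  exact: measurableT_comp.
- by move=> n y _; rewrite lee_fin mulr_ge0.
- by move=> y _ a b ab; rewrite lee_fin ler_wpM2r// gnd.
Qed.

End density.

Section independence.
Context d (T : measurableType d) (R : realType) (P : probability T R).

(** The product rule for events is the case where all factors are indicators;
    they are replaced by general functions one at a time.  For the factor of
    index [k], the induction hypothesis says that integrating the other factors
    over the event [U k \in C] gives a multiple of the law of [U k], and
    [ge0_integral_density] integrates [phi k] against that law. *)
Lemma expectation_prod_indep (U : nat -> {RV P >-> R}) (phi : nat -> R -> R) n :
  mutually_independent P (fun i w => U i w) ->
  (forall i, measurable_fun setT (phi i)) -> (forall i x, 0 <= phi i x) ->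
  (forall i, (\int[P]_w (phi i (U i w))%:E < +oo)%E) ->
  (\int[P]_w (\prod_(i < n) phi i (U i w))%:E =
   \prod_(i < n) \int[P]_w (phi i (U i w))%:E)%E.
Proof.
move=> indU mphi phi0 phioo.
have mpre i C : measurable C -> measurable (U i @^-1` C).
  by move=> mC; rewrite -[X in measurable X]setTI; exact: (@measurable_funP _ _ _ _ setT (U i)).
have intU1 i C : measurable C ->
    (\int[P]_w (\1_C (U i w))%:E)%E = P (U i @^-1` C).
  move=> mC; rewrite (_ : (fun w => _) = (fun w => (\1_(U i @^-1` C) w)%:E)).
    by rewrite integral_indic ?setIT//; exact: mpre.
  by apply/funext => w; rewrite !indicE.
(* the first [k] factors are already general, the others still indicators *)
pose psi k (B : nat -> set R) i : R -> R :=
  if (i < k)%N then phi i else \1_(B i).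
have psi0 k B i x : 0 <= psi k B i x by rewrite /psi; case: ifP.
have mpsi k B i : measurable (B i) -> measurable_fun setT (psi k B i).
  by move=> mB; rewrite /psi; case: ifP.
have mpsiU k B i : measurable (B i) ->
    measurable_fun setT (fun w => psi k B i (U i w)).
  by move=> mB; apply: measurableT_comp => //; exact: mpsi.
have intpsi k B i : measurable (B i) ->
    (\int[P]_w (psi k B i (U i w))%:E)%E \is a fin_num.
  move=> mB; rewrite ge0_fin_numE; last by apply: integral_ge0 => w _; rewrite lee_fin.
  rewrite /psi; case: ifP => // _.
  rewrite intU1//; apply: le_lt_trans (ltry 1).
  by apply: probability_le1; exact: mpre.
suff H k : (k <= n)%N -> forall B, (forall i, measurable (B i)) ->
    (\int[P]_w (\prod_(i < n) psi k B i (U i w))%:E =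
     \prod_(i < n) \int[P]_w (psi k B i (U i w))%:E)%E.
  have := H n (leqnn n) (fun=> setT) (fun=> measurableT).
  under eq_integral do under eq_bigr do rewrite /psi ltn_ord.
  by under eq_bigr do rewrite /psi ltn_ord.
elim: k => [_ B mB|k IH kn B mB].
  under [RHS]eq_bigr => i _ do rewrite intU1//.
  have := indU (iota 0 n) B (iota_uniq 0 n) mB.
  rewrite -[n in iota 0 n]subn0 -/(index_iota 0 n) big_mkord => <-.
  set S := [set w | _].
  have SE : S = \bigcap_(i in `I_n) (U i @^-1` B i).
    apply/seteqP; split => w /= Sw i.
      by move=> /= lin; apply: Sw; rewrite mem_index_iota.
    by rewrite mem_index_iota => /andP[_ lin]; exact: Sw.
  have mS : measurable S.
    by rewrite SE; apply: bigcap_measurableType => // i _; exact: mpre.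
  rewrite -[in RHS](setIT S) -integral_indic//.
  apply: eq_integral => w _; congr EFin; rewrite indicE.
  have [/[1!inE] Sw|/negP/[!inE] NSw] := boolP (w \in S).
    rewrite big1// => i _; rewrite /psi/= indicE mem_set//.
    by apply: Sw; rewrite mem_index_iota/=.
  have [i lin NB] : exists2 i, (i < n)%N & ~ B i (U i w).
    apply: contrapT => H; apply: NSw => i; rewrite mem_index_iota/= => lin.
    by apply: contrapT => NB; apply: H; exists i.
  by rewrite (bigD1 (Ordinal lin))//= /psi/= indicE memNset// mul0r.
pose ok := Ordinal kn.
pose Z w := \prod_(i < n | i != ok) psi k.+1 B i (U i w).
pose c := (\prod_(i < n | i != ok) \int[P]_w (psi k.+1 B i (U i w))%:E)%E.
have c0 : (0 <= c)%E.
  by apply: prode_ge0 => i _; apply: integral_ge0 => w _; rewrite lee_fin.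
have cfin : c \is a fin_num.
  by apply: prode_fin_num => i _; exact: intpsi.
have fc0 : 0 <= fine c by exact: fine_ge0.
transitivity (\int[P]_w (phi k (U k w) * Z w)%:E)%E.
  apply: eq_integral => w _; congr EFin.
  by rewrite (bigD1 ok)//= /psi ltnSn.
rewrite -(@ge0_integral_density _ _ _ _ _ _
  (mscale (NngNum fc0) (distribution P (U k))))//.
- rewrite ge0_integral_mscale//=; [|exact/measurable_EFinP| by move=> *; rewrite lee_fin].
  rewrite ge0_integral_distribution//; [|exact/measurable_EFinP| by move=> *; rewrite lee_fin].
  rewrite [RHS](bigD1 ok)//= fineK// muleC -/c; congr (_ * _)%E.
  by apply: eq_integral => w _ /=; rewrite /psi ltnSn.
- rewrite /Z; under eq_fun do rewrite -big_filter.
  by apply: measurable_prod => i _; exact: mpsiU.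
- by move=> w; apply: prodr_ge0.
move=> C mC; transitivity (c * distribution P (U k) C)%E.
  by rewrite -[in RHS](fineK cfin).
pose B' i := if i == k then C else B i.
have mB' i : measurable (B' i) by rewrite /B'; case: ifP.
have psiB' i : i != k -> psi k B' i = psi k.+1 B i.
  by move=> ik; rewrite /psi /B' (negbTE ik) ltnS (leq_eqVlt i k) (negbTE ik).
have psik : psi k B' k = \1_C by rewrite /psi ltnn /B' eqxx.
have := IH (ltnW kn) B' mB'.
rewrite (bigD1 ok)//= psik.
rewrite (_ : (\int[P]_w (\1_C (U k w))%:E)%E = distribution P (U k) C); last exact: intU1.
under [X in (_ = _ * X)%E -> _]eq_bigr => i ik do rewrite psiB'//.
rewrite -/c muleC => <-.
rewrite [RHS]integral_mkcond; apply: eq_integral => w _.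
rewrite epatch_indic/= -EFinM mulrC; congr EFin.
rewrite (bigD1 ok)//= psik; congr (_ * _).
by apply: eq_bigr => i ik; rewrite psiB'.
Qed.

End independence.

(** * Uniform concentration of averages *)

(** The inverse of [1 - y <= expR (- y)] is enough: (1 - y) (1 + y + 2 y^2) - 1
    equals y^2 (1 - 2 y). *)
Lemma expR_le_quadratic (R : realType) (y : R) :
  y <= 1 / 2 -> expR y <= 1 + y + 2 * y ^+ 2.
Proof.
move=> y12; have H := expR_ge1Dx (- y).
have e0 := expR_gt0 y; have q : 0 < 1 - y by lra.
rewrite -(ler_pM2l q); apply: (@le_trans _ _ 1).
  by rewrite -[leRHS](expRxMexpNx_1 y) [leRHS]mulrC ler_pM2r.
have : 0 <= y ^+ 2 * (1 - 2 * y) by rewrite mulr_ge0 ?sqr_ge0//; lra.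
lra.
Qed.

Section real_integrable.
Context d (T : measurableType d) (R : realType).
Variable mu : {measure set T -> \bar R}.
Implicit Types f g : T -> R.

Lemma integrable_add f g :
  mu.-integrable setT (EFin \o f) -> mu.-integrable setT (EFin \o g) ->
  mu.-integrable setT (EFin \o (fun w => f w + g w)).
Proof. exact: integrableD. Qed.

Lemma integrable_scale c f :
  mu.-integrable setT (EFin \o f) ->
  mu.-integrable setT (EFin \o (fun w => c * f w)).
Proof. exact: integrableZl. Qed.

End real_integrable.

Section concentration.
Context d (T : measurableType d) (R : realType) (P : probability T R).

Lemma bounded_integrable (g : T -> R) (A : R) :
  measurable_fun setT g -> (forall x, `|g x| <= A) ->
  P.-integrable setT (EFin \o g).
Proof.
move=> mg gA; apply: measurable_bounded_integrable => //.
  exact: le_lt_trans (probability_le1 P measurableT) (ltry 1).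
exists A; split; first by rewrite num_real.
by move=> B AB x _; exact: le_trans (gA x) (ltW AB).
Qed.

Lemma Rintegral_prob_cst (c : R) : \int[P]_w c = c.
Proof.
rewrite Rintegral_cst// -[RHS]mulr1; congr (_ * _).
exact: (congr1 fine (probability_setT P)).
Qed.

Lemma measurable_superlevel (phi : T -> R) (t : R) :
  measurable_fun setT phi -> measurable [set w | (t <= phi w)%R].
Proof.
move=> mphi; rewrite (_ : mkset _ = phi @^-1` `[t, +oo[).
  by rewrite -[X in measurable X]setTI; apply: mphi.
by apply/seteqP; split => w /=; rewrite in_itv/= andbT.
Qed.

(** The exponential moment of a centred variable with [lam * q <= 1 / 2] is at most
    1 + 2 lam^2 V.  Only the second moment enters, which is what makes the bound
    sharp for functions supported on a window of width [h]. *)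
Lemma chernoff_sum (U : nat -> {RV P >-> R}) (q : R -> R) (A V lam t : R) n :
  mutually_independent P (fun i w => U i w) ->
  measurable_fun setT q -> (forall x, `|q x| <= A) ->
  (forall i, \int[P]_w q (U i w) = 0) ->
  (forall i, \int[P]_w q (U i w) ^+ 2 <= V) ->
  0 <= lam -> lam * A <= 1 / 2 ->
  (P [set w | (t <= \sum_(i < n) q (U i w))%R] <=
   (expR (2 * n%:R * lam ^+ 2 * V - lam * t))%:E)%E.
Proof.
move=> indU mq qA Eq0 EqV lam0 lamA.
pose phi x := expR (lam * q x).
have mlq : measurable_fun setT (fun x => lam * q x) by exact: measurable_funM.
have mphi : measurable_fun setT phi by exact: measurableT_comp.
have mqU i : measurable_fun setT (fun w => q (U i w)) by exact: measurableT_comp.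
have mphiU i : measurable_fun setT (fun w => phi (U i w)) by exact: measurableT_comp.
have iq i : P.-integrable setT (EFin \o (fun w => q (U i w))).
  by apply: (bounded_integrable (mqU i)) => w; exact: qA.
have iq2 i : P.-integrable setT (EFin \o (fun w => q (U i w) ^+ 2)).
  apply: (@bounded_integrable _ (A ^+ 2)).
    by apply: measurable_funX.
  by move=> w; rewrite normrX ler_pXn2r// nnegrE// (le_trans _ (qA (U i w))).
have lamqA x : `|lam * q x| <= 1 / 2.
  by rewrite normrM ger0_norm// (le_trans _ lamA)// ler_wpM2l.
have iphi i : P.-integrable setT (EFin \o (fun w => phi (U i w))).
  apply: (@bounded_integrable _ (expR (1 / 2))) => // w.
  rewrite /phi ger0_norm ?expR_ge0// ler_expR.
  by rewrite (le_trans (ler_norm _)).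
have Ephi i : (\int[P]_w (phi (U i w))%:E <= (expR (2 * lam ^+ 2 * V))%:E)%E.
  rewrite -[leLHS]fineK; last exact: (integrable_fin_num _ (iphi i)).
  rewrite lee_fin; apply: le_trans (expR_ge1Dx _).
  have i1 : P.-integrable setT (EFin \o (fun w : T => 1 : R)).
    exact: finite_measure_integrable_cst.
  have i2 := integrable_scale lam (iq i).
  have i3 := integrable_scale (2 * lam ^+ 2) (iq2 i).
  have i4 := integrable_add i1 i2; have ir := integrable_add i4 i3.
  apply: (@le_trans _ _ (\int[P]_w
     ((1 + lam * q (U i w)) + 2 * lam ^+ 2 * q (U i w) ^+ 2))).
    apply: le_Rintegral => // w _.
    rewrite -[2 * _ * _]mulrA -exprMn.
    by apply: expR_le_quadratic; rewrite (le_trans (ler_norm _)).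
  rewrite RintegralD// RintegralD// Rintegral_prob_cst.
  rewrite RintegralZl// RintegralZl// Eq0 mulr0 addr0 lerD2l.
  by rewrite ler_wpM2l// mulr_ge0// sqr_ge0.
set B := [set w | _].
have mS : measurable_fun setT (fun w => \sum_(i < n) q (U i w)).
  by apply: measurable_sum => i.
have mB : measurable B by exact: measurable_superlevel.
have mprod : measurable_fun setT (fun w => \prod_(i < n) phi (U i w)).
  by apply: measurable_prod => i _; exact: mphiU.
rewrite -(setIT B) -integral_indic//.
apply: (@le_trans _ _
   (\int[P]_w ((expR (- (lam * t)))%:E * (\prod_(i < n) phi (U i w))%:E)%E)%E).
  apply: ge0_le_integral => //.
  - by apply/measurable_EFinP; exact: measurable_indic.
  - by apply: emeasurable_funM => //; exact/measurable_EFinP.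
  move=> w _; rewrite -EFinM lee_fin indicE.
  have [/[1!inE] Bw|_] := boolP (w \in B); last first.
    by rewrite mulr_ge0 ?expR_ge0// prodr_ge0// => i _; exact: expR_ge0.
  rewrite /phi -expR_sum -expRD -mulr_sumr.
  by rewrite -[1%:R](@expR0 R) ler_expR addrC subr_ge0 ler_wpM2l.
rewrite ge0_integralZl//; last 2 first.
- exact/measurable_EFinP.
- by move=> w _; rewrite lee_fin prodr_ge0// => i _; exact: expR_ge0.
rewrite (@expectation_prod_indep _ _ _ _ _ (fun=> phi))//; last 2 first.
- by move=> _ x; exact: expR_ge0.
- by move=> i; apply: le_lt_trans (Ephi i) _; rewrite ltry.
rewrite expRD [in leRHS]EFinM muleC lee_wpmul2r ?lee_fin ?expR_ge0//.
apply: (@le_trans _ _ (\prod_(i < n) (expR (2 * lam ^+ 2 * V))%:E)%E).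
  have phiK i : (\int[P]_w (phi (U i w))%:E)%E = (\int[P]_w phi (U i w))%:E.
    by rewrite fineK//; exact: (integrable_fin_num _ (iphi i)).
  under eq_bigr do rewrite phiK.
  rewrite !prodEFin lee_fin; apply: ler_prod => i _.
  rewrite Rintegral_ge0/=; last by move=> w _; exact: expR_ge0.
  by rewrite -lee_fin -phiK.
rewrite prodEFin lee_fin prodr_const card_ord -expRM_natl.
by rewrite !mulrA [n%:R * 2]mulrC.
Qed.

End concentration.

Section two_sided.
Context d (T : measurableType d) (R : realType) (P : probability T R).

Lemma mean_deviation (U : nat -> {RV P >-> R}) (g : R -> R) (e A V lam t : R) n :
  mutually_independent P (fun i w => U i w) ->
  measurable_fun setT g -> (forall x, `|g x| <= A) ->
  (forall i, \int[P]_w g (U i w) = e) ->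
  (forall i, \int[P]_w g (U i w) ^+ 2 <= V) ->
  0 <= lam -> lam * (2 * A) <= 1 / 2 ->
  (P [set w | (t <= `|\sum_(i < n) (g (U i w) - e)|)%R] <=
   (2 * expR (2 * n%:R * lam ^+ 2 * V - lam * t))%:E)%E.
Proof.
move=> indU mg gA Ee EV lam0 lamA.
have mgU i : measurable_fun setT (fun w => g (U i w)) by exact: measurableT_comp.
have ig i : P.-integrable setT (EFin \o (fun w => g (U i w))).
  by apply: (bounded_integrable P (mgU i)) => w; exact: gA.
have ig2 i : P.-integrable setT (EFin \o (fun w => g (U i w) ^+ 2)).
  apply: (@bounded_integrable _ _ _ _ _ (A ^+ 2)).
    by apply: measurable_funX.
  by move=> w; rewrite normrX ler_pXn2r// nnegrE// (le_trans _ (gA (U i w))).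
have i1 (c : R) : P.-integrable setT (EFin \o (fun w : T => c)).
  exact: finite_measure_integrable_cst.
have eA : `|e| <= A.
  rewrite -(Ee 0%N); apply: le_trans (le_normr_Rintegral measurableT (ig 0%N)) _.
  rewrite -[leRHS](Rintegral_prob_cst P); apply: le_Rintegral => //.
  exact: integrable_norm (ig 0%N).
pose q (s x : R) := s * (g x - e).
have H s : `|s| = 1 ->
    (P [set w | (t <= \sum_(i < n) q s (U i w))%R] <=
     (expR (2 * n%:R * lam ^+ 2 * V - lam * t))%:E)%E.
  move=> s1.
  have s2 : s ^+ 2 = 1 by rewrite -[s ^+ 2]real_normK ?num_real// s1 expr1n.
  apply: (@chernoff_sum _ _ _ _ _ (q s) (2 * A)) => //.
  - by apply: measurable_funM => //; exact: measurable_funB.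
  - move=> x; rewrite normrM s1 mul1r (le_trans (ler_normB _ _))//.
    by rewrite mulr2n mulrDl mul1r lerD.
  - move=> i; rewrite RintegralZl//; last first.
      exact: (integrable_add (ig i) (i1 (- e))).
    rewrite (RintegralD measurableT (ig i) (i1 (- e))).
    by rewrite Ee Rintegral_prob_cst subrr mulr0.
  - move=> i.
    rewrite (_ : (fun w => _) =
      (fun w => (g (U i w) ^+ 2 + (- (2 * e)) * g (U i w)) + e ^+ 2)); last first.
      by apply/funext => w; rewrite /q exprMn s2; ring.
    have j2 := integrable_scale (- (2 * e)) (ig i).
    have j3 := integrable_add (ig2 i) j2.
    rewrite RintegralD// RintegralD// RintegralZl// Ee Rintegral_prob_cst.
    have := EV i; have := sqr_ge0 e; lra.
have mS s : measurable [set w | (t <= \sum_(i < n) q s (U i w))%R].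
  apply: measurable_superlevel; apply: measurable_sum => i.
  by apply: measurable_funM => //; exact: measurable_funB.
apply: (@le_trans _ _ (P ([set w | (t <= \sum_(i < n) q 1 (U i w))%R] `|`
    [set w | (t <= \sum_(i < n) q (-1) (U i w))%R]))).
  apply: le_measure; rewrite ?inE//.
  - apply: measurable_superlevel; apply: measurableT_comp => //.
    by apply: measurable_sum => i; exact: measurable_funB.
  - exact: measurableU.
  move=> w /=; rewrite /q -!mulr_sumr mul1r mulN1r.
  by rewrite ler_normr => /orP.
apply: le_trans (measureU2 _ (mS 1) (mS (-1))) _.
rewrite mulr2n mulrDl mul1r EFinD; apply: leeD; apply: H.
  by rewrite normr1.
by rewrite normrN1.
Qed.

End two_sided.

Section bandwidth.
Context (R : realType) (h : nat -> R).
Hypotheses (h_gt0 : forall n, 0 < h n)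
  (nh_cvgy : n%:R * h n / ln n%:R @[n --> \oo] --> +oo).

Lemma near_ln_ge1 : \forall n \near \oo, 1 <= ln (n%:R : R).
Proof.
near=> n.
have e0 : 0 < expR 1 :> R by exact: expR_gt0.
have en : expR 1 <= n%:R :> R by near: n; exact: nbhs_infty_ger.
by rewrite -[leLHS](@expRK R) ler_ln// posrE// (lt_le_trans e0).
Unshelve. all: by end_near. Qed.

Lemma near_ln_le_nh (C : R) : \forall n \near \oo, C * ln n%:R <= n%:R * h n.
Proof.
near=> n.
have ln1 : 1 <= ln (n%:R : R) by near: n; exact: near_ln_ge1.
have ln0 : 0 < ln (n%:R : R) by rewrite (lt_le_trans _ ln1).
rewrite -ler_pdivlMr//; near: n.
by move/cvgryPge : nh_cvgy => /(_ C).
Unshelve. all: by end_near. Qed.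

Lemma near_nh_ge1 : \forall n \near \oo, 1 <= n%:R * h n.
Proof.
near=> n.
have ln1 : 1 <= ln (n%:R : R) by near: n; exact: near_ln_ge1.
by rewrite (le_trans ln1)// -[leLHS]mul1r; near: n; exact: near_ln_le_nh.
Unshelve. all: by end_near. Qed.

(** This is the parameter of the exponential tilt: with it, [chernoff_sum] is
    usable for functions bounded independently of n. *)
Lemma near_tilt_le (c : R) : 0 < c ->
  \forall n \near \oo, Num.sqrt (ln n%:R / (n%:R * h n)) <= c.
Proof.
move=> c0; near=> n.
have nh1 : 1 <= n%:R * h n by near: n; exact: near_nh_ge1.
have nh0 : 0 < n%:R * h n by rewrite (lt_le_trans _ nh1).
rewrite -(ger0_norm (ltW c0)) -sqrtr_sqr ler_wsqrtr// ler_pdivrMr//.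
rewrite -ler_pdivrMl ?exprn_gt0//; near: n; exact: near_ln_le_nh.
Unshelve. all: by end_near. Qed.

(** Standard deviation of an average of n variables of variance h, inflated by
    the factor sqrt (log n) that uniformity costs. *)
Definition rate n : R := Num.sqrt (h n * ln n%:R / n%:R).

Lemma rate_ge0 n : 0 <= rate n. Proof. exact: sqrtr_ge0. Qed.

(** Deviations of size [rate] are negligible before the mean of order h of the
    denominator of the smoother. *)
Lemma near_rate_le (c : R) : 0 < c -> \forall n \near \oo, rate n <= c * h n.
Proof.
move=> c0; near=> n.
have n0 : (0 < n)%N by near: n; exact: nbhs_infty_gt.
rewrite -(ger0_norm (mulr_ge0 (ltW c0) (ltW (h_gt0 n)))) -sqrtr_sqr ler_wsqrtr//.
rewrite ler_pdivrMr ?ltr0n// exprMn.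
rewrite (_ : _ * n%:R = h n * (c ^+ 2 * (n%:R * h n))); last by ring.
rewrite ler_pM2l// -ler_pdivrMl ?exprn_gt0//; near: n; exact: near_ln_le_nh.
Unshelve. all: by end_near. Qed.

(** The discretization error 1 / n of a grid of mesh n^(-3) is negligible. *)
Lemma near_rate_ge : \forall n \near \oo, n%:R^-1 <= rate n.
Proof.
near=> n.
have n0 : (0 < n)%N by near: n; exact: nbhs_infty_gt.
have nh1 : 1 <= n%:R * h n by near: n; exact: near_nh_ge1.
have ln1 : 1 <= ln (n%:R : R) by near: n; exact: near_ln_ge1.
have i0 : 0 < n%:R^-1 :> R by rewrite invr_gt0 ltr0n.
rewrite -(ger0_norm (ltW i0)) -sqrtr_sqr ler_wsqrtr//.
rewrite ler_pdivlMr ?ltr0n// expr2 -mulrA mulVf ?pnatr_eq0 -?lt0n// mulr1.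
rewrite -[leLHS]mul1r ler_pdivrMr ?ltr0n//.
by rewrite (le_trans nh1)// [leLHS]mulrC ler_wpM2r ?ler0n// ler_peMr// ltW.
Unshelve. all: by end_near. Qed.

End bandwidth.

(** The minimum keeps every grid point inside the interval; points near [x] are
    always taken on the left of [x], where the minimum is not active. *)
Definition grid (R : realType) (a b : R) N k : R := Num.min (a + k%:R / N%:R) b.

Lemma grid_itv (R : realType) (a b : R) N k : a <= b -> grid a b N k \in `[a, b].
Proof.
move=> ab; rewrite in_itv/= /grid ge_min lexx orbT le_min ab !andbT.
by rewrite lerDl divr_ge0.
Qed.

Lemma grid_near (R : realType) (a b x : R) N : (0 < N)%N -> b - a <= 1 ->
  x \in `[a, b] -> exists2 k, (k < N.+1)%N & `|x - grid a b N k| <= N%:R^-1.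
Proof.
move=> N0 ba /itvP xab.
have N0' : 0 < N%:R :> R by rewrite ltr0n.
have xa0 : 0 <= (x - a) * N%:R by rewrite mulr_ge0 ?ler0n// subr_ge0 xab.
have /andP[k1 k2] := truncn_itv xa0.
set k := Num.truncn _ in k1 k2; exists k.
  rewrite ltnS -(ler_nat R) (le_trans k1)// ler_piMl ?ler0n//.
  by rewrite (le_trans _ ba)// lerD2r xab.
have kx : k%:R / N%:R <= x - a by rewrite ler_pdivrMr.
have xk : x - a < k%:R / N%:R + N%:R^-1.
  by rewrite -[X in _ < _ + X]mul1r -mulrDl ltr_pdivlMr// natr1.
rewrite /grid min_l; last by rewrite -lerBrDl (le_trans kx)// lerD2r xab.
by rewrite ger0_norm; lra.
Qed.

Lemma le_outer_prob d (T : measurableType d) (R : realType)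
    (P : probability T R) (A B : set T) :
  A `<=` B -> ((P^*)%mu A <= (P^*)%mu B)%E.
Proof. exact: le_mu_ext. Qed.

Lemma Rintegral_dist d (T : measurableType d) (R : realType)
    (P : probability T R) (f g : T -> R) (c : R) :
  P.-integrable setT (EFin \o f) -> P.-integrable setT (EFin \o g) ->
  (forall w, `|f w - g w| <= c) -> `|\int[P]_w f w - \int[P]_w g w| <= c.
Proof.
move=> If Ig fg; have Ifg := integrable_add If (integrable_scale (-1) Ig).
rewrite -RintegralB//.
rewrite (_ : (fun w => _) = (fun w => f w + -1 * g w)); last first.
  by apply/funext => w; rewrite mulN1r.
apply: le_trans (le_normr_Rintegral measurableT Ifg) _.
rewrite -[leRHS](Rintegral_prob_cst P); apply: le_Rintegral => //.
- exact: integrable_norm Ifg.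
- exact: finite_measure_integrable_cst.
- by move=> w _; rewrite mulN1r.
Qed.

Section uniform.
Context d (T : measurableType d) (R : realType) (P : probability T R).
Context (h : nat -> R) (U : nat -> {RV P >-> R}).
Hypotheses (h_gt0 : forall n, 0 < h n)
  (nh_cvgy : n%:R * h n / ln n%:R @[n --> \oo] --> +oo)
  (indU : mutually_independent P (fun i w => U i w)).

(** With the tilt lam = sqrt (log n / (n h)), one has n lam^2 h = log n and
    n lam [rate] = log n, so the exponent of [mean_deviation] at the threshold
    n (2 V + 4) [rate] is exactly - 4 log n.  The resulting bound 2 n^(-4) is
    summed over the n^3 + 1 points of a grid; moving from x to the nearest grid
    point changes the average and its mean by at most L / n each. *)
Lemma uniform_deviation (a b A V L : R) (G : nat -> R -> R -> R)
    (E : nat -> R -> R) :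
  a <= b -> b - a <= 1 -> 0 < A -> 0 <= V -> 0 <= L ->
  (\forall n \near \oo, forall x, x \in `[a, b] ->
     [/\ measurable_fun setT (G n x), forall u, `|G n x u| <= A,
         forall i, \int[P]_w G n x (U i w) = E n x &
         forall i, \int[P]_w G n x (U i w) ^+ 2 <= V * h n]) ->
  (\forall n \near \oo, forall x y u, x \in `[a, b] -> y \in `[a, b] ->
     `|G n x u - G n y u| <= L * n%:R ^+ 2 * `|x - y|) ->
  bigO_p P (fun n w => ereal_sup
      [set `|n%:R^-1 * \sum_(i < n) G n x (U i w) - E n x|%:E | x in `[a, b]])
    (rate h).
Proof.
move=> ab ba A0 V0 L0 nearG nearL.
(* [M0] serves at the grid points, [2 * L] pays for the discretization *)
pose M0 := 2 * V + 4; pose M := M0 + 2 * L.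
have M00 : 0 < M0 by rewrite /M0; lra.
move=> eta eta0; exists M; first by rewrite /M; lra.
near=> n.
have n0 : (0 < n)%N by near: n; exact: nbhs_infty_gt.
have n0' : 0 < n%:R :> R by rewrite ltr0n.
have hn := h_gt0 n.
have GE : forall x, x \in `[a, b] ->
     [/\ measurable_fun setT (G n x), forall u, `|G n x u| <= A,
         forall i, \int[P]_w G n x (U i w) = E n x &
         forall i, \int[P]_w G n x (U i w) ^+ 2 <= V * h n].
  by near: n.
have GL : forall x y u, x \in `[a, b] -> y \in `[a, b] ->
     `|G n x u - G n y u| <= L * n%:R ^+ 2 * `|x - y| by near: n.
have ln1 : 1 <= ln (n%:R : R) by near: n; exact: near_ln_ge1.
have tilt : Num.sqrt (ln n%:R / (n%:R * h n)) <= (4 * A)^-1.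
  by near: n; apply: near_tilt_le => //; rewrite invr_gt0 mulr_gt0.
have rn : n%:R^-1 <= rate h n by near: n; exact: near_rate_ge.
have n4 : 4 / n%:R <= eta.
  rewrite ler_pdivrMr// mulrC -ler_pdivrMr//; near: n; exact: nbhs_infty_ger.
pose lam := Num.sqrt (ln n%:R / (n%:R * h n)).
have l0 : 0 <= ln n%:R :> R by rewrite (le_trans _ ln1).
have q0 := divr_ge0 l0 (mulr_ge0 (ler0n R n) (ltW hn)).
have lam2 : n%:R * lam ^+ 2 * h n = ln n%:R.
  rewrite /lam sqr_sqrtr//.
  by field; rewrite !gt_eqF.
have lamrate : lam * (n%:R * rate h n) = ln n%:R.
  rewrite /lam /rate mulrCA -sqrtrM//.
  rewrite (_ : _ * (_ / _) = (ln n%:R / n%:R) ^+ 2); last first.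
    by field; rewrite !gt_eqF.
  by rewrite sqrtr_sqr ger0_norm ?divr_ge0// mulrCA divff ?mulr1// gt_eqF.
pose t := n%:R * (M0 * rate h n).
pose N := (n ^ 3)%N.
have N0 : (0 < N)%N by rewrite expn_gt0 n0.
pose B k := let y := grid a b N k in
  [set w | (t <= `|\sum_(i < n) (G n y (U i w) - E n y)|)%R].
have mB k : measurable (B k).
  have [mG _ _ _] := GE _ (grid_itv N k ab).
  apply: measurable_superlevel; apply: measurableT_comp => //.
  apply: measurable_sum => i.
  by apply: measurable_funB => //; exact: measurableT_comp.
have PB k : (P (B k) <= (2 * (n%:R ^+ 4)^-1)%:E)%E.
  have [mG GA GEx GV] := GE _ (grid_itv N k ab).
  apply: le_trans (@mean_deviation _ _ _ _ _ _ _ _ _ lam t n indU mG GA GEx GV _ _) _.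
  - exact: sqrtr_ge0.
  - rewrite -ler_pdivlMr ?mulr_gt0// (le_trans tilt)//.
    by rewrite le_eqVlt; apply/orP; left; apply/eqP; field; rewrite gt_eqF.
  rewrite lee_fin ler_pM2l//.
  rewrite (_ : _ - _ = - (4%:R * ln n%:R)); last first.
    transitivity (2 * V * (n%:R * lam ^+ 2 * h n) - M0 * (lam * (n%:R * rate h n))).
      by rewrite /t; ring.
    by rewrite lam2 lamrate /M0; ring.
  by rewrite expRN expRM_natl lnK.
apply: (@le_trans _ _ ((P^*)%mu (\big[setU/set0]_(k < N.+1) B k))).
  apply: le_outer_prob => w /= /ereal_sup_gt[_ [x xab <-]].
  rewrite lte_fin => Mx; have {}xab : x \in `[a, b] by [].
  have [k kN xk] := grid_near N0 ba xab.
  have gk := grid_itv N k ab; set y := grid _ _ _ _ in xk gk.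
  rewrite -bigcup_mkord; exists k => //=.
  have [mGx GAx GEx _] := GE _ xab; have [mGy GAy GEy _] := GE _ gk.
  have n3 : L * n%:R ^+ 2 * `|x - y| <= L / n%:R.
    rewrite -mulrA ler_wpM2l// -ler_pdivlMl ?exprn_gt0// (le_trans xk)//.
    by rewrite natrX -invfM -exprSr.
  have Exy : `|E n x - E n y| <= L / n%:R.
    rewrite -(GEx 0%N) -(GEy 0%N); apply: Rintegral_dist.
    - apply: (@bounded_integrable _ _ _ _ _ A); first exact: measurableT_comp.
      by move=> ?; exact: GAx.
    - apply: (@bounded_integrable _ _ _ _ _ A); first exact: measurableT_comp.
      by move=> ?; exact: GAy.
    by move=> v; apply: le_trans (GL _ _ _ xab gk) n3.
  have Sxy : `|n%:R^-1 * \sum_(i < n) G n x (U i w) -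
               n%:R^-1 * \sum_(i < n) G n y (U i w)| <= L / n%:R.
    rewrite -mulrBr -sumrB normrM (ger0_norm (_ : 0 <= n%:R^-1)) ?invr_ge0 ?ler0n// mulrC.
    rewrite ler_pdivrMr// (le_trans (ler_norm_sum _ _ _))//.
    apply: (@le_trans _ _ (\sum_(i < n) L / n%:R)).
      by apply: ler_sum => i _; apply: le_trans (GL _ _ _ xab gk) n3.
    by rewrite sumr_const card_ord mulr_natr.
  have Lr : L / n%:R <= L * rate h n by rewrite ler_wpM2l.
  rewrite /B/= sumrB sumr_const card_ord -mulr_natl.
  rewrite (_ : _ - _ = n%:R *
     (n%:R^-1 * \sum_(i < n) G n y (U i w) - E n y)); last first.
    by rewrite mulrBr mulVKf// gt_eqF.
  rewrite normrM (ger0_norm (ltW n0')) /t ler_pM2l//.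
  move: Mx Exy Sxy; rewrite /M.
  set u1 := n%:R^-1 * \sum_(i < n) G n x (U i w).
  set u2 := n%:R^-1 * \sum_(i < n) G n y (U i w) => Mx Exy Sxy.
  have : `|u1 - E n x| <= `|u2 - E n y| + `|E n x - E n y| + `|u1 - u2|.
    rewrite -[X in `|X| <= _](_ : (u2 - E n y) - (E n x - E n y) + (u1 - u2) = _).
      by rewrite (le_trans (ler_normD _ _))// lerD2r ler_normB.
    by ring.
  lra.
rewrite measurable_mu_extE; last by apply: bigsetU_measurable.
apply: le_trans (Boole_inequality _ _) _ => //.
apply: (@le_trans _ _ (\sum_(k < N.+1) (2 * (n%:R ^+ 4)^-1)%:E)%E).
  by apply: lee_sum => k _; exact: PB.
rewrite sumEFin lee_fin (le_trans _ n4)// sumr_const card_ord -[leLHS]mulr_natl.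
rewrite (_ : 4 / n%:R = (2 * n%:R ^+ 3) * (2 * (n%:R ^+ 4)^-1)); last first.
  by field; rewrite gt_eqF.
rewrite ler_wpM2r ?mulr_ge0 ?invr_ge0 ?exprn_ge0 ?ler0n//.
rewrite -natr1 natrX mulr2n mulrDl mul1r lerD2l.
by rewrite exprn_ege1// ler1n.
Unshelve. all: by end_near.
Qed.

End uniform.

(** * Kernels and their moments *)

Section compact_support.
Context (R : realType).
Notation mu := (@lebesgue_measure R).
Implicit Types (F Phi : R -> R) (a b x h : R).

Lemma patch_vanish Phi a b :
  (forall u, u \notin `[a, b] -> Phi u = 0) -> Phi \_ `[a, b] = Phi.
Proof.
move=> Phi0; apply/funext => u; rewrite patchE; case: ifPn => // /negP uab.
by rewrite Phi0//; apply/negP => uab'; apply: uab; rewrite inE.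
Qed.

Lemma integrable_compact_support Phi a b : continuous Phi ->
  (forall u, u \notin `[a, b] -> Phi u = 0) ->
  mu.-integrable setT (EFin \o Phi).
Proof.
move=> cPhi Phi0; rewrite -(patch_vanish Phi0) -restrict_EFin.
apply: (proj1 (@integrable_mkcond _ _ R mu `[a, b]%classic (EFin \o Phi) _)).
  exact: measurable_itv.
apply: continuous_compact_integrable; first exact: segment_compact.
by apply: continuous_subspaceT => u; exact: cPhi.
Qed.

Lemma Rintegral_compact_support Phi a b :
  (forall u, u \notin `[a, b] -> Phi u = 0) ->
  \int[mu]_u Phi u = \int[mu]_(u in `[a, b]) Phi u.
Proof. by move=> Phi0; rewrite [RHS]Rintegral_mkcond patch_vanish. Qed.

Lemma continuous_rescale F x h : continuous F -> continuous (fun u => F ((u - x) / h)).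
Proof.
move=> cF u; apply: (@continuous_comp _ _ _ (fun u => (u - x) / h) F); last exact: cF.
by apply: continuousM; [apply: continuousB => //; exact: cvg_cst|exact: cvg_cst].
Qed.

Lemma rescale_vanish F x h u : 0 < h -> (forall v, 1 < `|v| -> F v = 0) ->
  u \notin `[x - h, x + h] -> F ((u - x) / h) = 0.
Proof.
move=> h0 F0 xu; apply: F0; rewrite normrM normfV (gtr0_norm h0) ltr_pdivlMr// mul1r.
by move: xu; rewrite in_itv/= -ler_distl ltNge.
Qed.

Lemma integral_rescale F x h : 0 < h -> continuous F ->
  (forall v, 1 < `|v| -> F v = 0) ->
  \int[mu]_u F ((u - x) / h) = h * \int[mu]_v F v.
Proof.
move=> h0 cF F0.
have F0' v : v \notin `[-1, 1] -> F v = 0.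
  by rewrite in_itv/= -ler_norml -ltNge; exact: F0.
rewrite (Rintegral_compact_support (fun u => @rescale_vanish F x h u h0 F0)).
rewrite (Rintegral_compact_support F0') -RintegralZl//; last first.
  apply: continuous_compact_integrable; first exact: segment_compact.
  by apply: continuous_subspaceT => u; exact: cF.
pose A v : R := x + h * v.
have A' : A^`()%classic = cst h.
  apply/funext => v; rewrite derive1E /A.
  by rewrite deriveD// derive_cst add0r deriveZ//= derive_id scaler1.
have -> : x - h = A (-1) by rewrite /A mulrN1.
have -> : x + h = A 1 by rewrite /A mulr1.
rewrite /Rintegral (@integration_by_substitution_increasing R A _ (-1) 1)//=.
- congr fine; apply: eq_integral => v _; rewrite A' mulrC.
  have Av : (A v - x) / h = v by rewrite /A; field; rewrite gt_eqF.
  by transitivity (h * F ((A v - x) / h))%:E => //; rewrite Av.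
- by move=> u v _ _ uv; rewrite /A ltrD2l ltr_pM2l.
- by rewrite A' => v _; exact: cvg_cst.
- by rewrite A'; exact: is_cvg_cst.
- by rewrite A'; exact: is_cvg_cst.
- have cA : continuous A.
    move=> v; apply: continuousD; first exact: cvg_cst.
    by apply: continuousM => //; exact: cvg_cst.
  split.
  + by move=> v _; apply: derivableD => //; apply: derivableM.
  + exact/cvg_at_right_filter/cA.
  + exact/cvg_at_left_filter/cA.
- by apply: continuous_subspaceT => u; exact: continuous_rescale.
Qed.

Lemma integral_odd F : continuous F -> (forall v, 1 < `|v| -> F v = 0) ->
  (forall v, F (- v) = - F v) -> \int[mu]_v F v = 0.
Proof.
move=> cF F0 Fodd.
have F0' v : v \notin `[-1, 1] -> F v = 0.
  by rewrite in_itv/= -ler_norml -ltNge; exact: F0.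
have iF : mu.-integrable `[-1, 1] (EFin \o F).
  apply: continuous_compact_integrable; first exact: segment_compact.
  by apply: continuous_subspaceT => u; exact: cF.
rewrite (Rintegral_compact_support F0').
set I := LHS; suff : I = - I by lra.
have -> : - I = \int[mu]_(v in `[-1, 1]) (-1 * F v).
  by rewrite RintegralZl// mulN1r.
rewrite /I /Rintegral.
have := @integration_by_substitution_oppr R F (-1) 1.
rewrite opprK => ->//; last by apply: continuous_subspaceT => u; exact: cF.
by congr fine; apply: eq_integral => v _ /=; rewrite Fodd mulN1r.
Qed.

End compact_support.

Lemma lipschitz_continuous (R : realType) (F : R -> R) (L : R) : 0 < L ->
  (forall u v, `|F u - F v| <= L * `|u - v|) -> continuous F.
Proof.
move=> L0 FL u; apply/cvgrPdist_lt => e e0.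
near=> v; rewrite (le_lt_trans (FL _ _))// mulrC -ltr_pdivlMr//.
near: v; apply: cvgr_dist_lt => //; exact: divr_gt0.
Unshelve. all: by end_near. Qed.

Section kernel.
Context (R : realType) (K : R -> R).
Notation mu := (@lebesgue_measure R).
Hypothesis kernelK : kernel_function K.

Lemma kernel_ge0 u : 0 <= K u. Proof. by case: kernelK. Qed.

Lemma kernel_out u : 1 < `|u| -> K u = 0. Proof. by case: kernelK => ? ? ? ?; exact. Qed.

Lemma kernel_lipschitz :
  exists2 L, 0 < L & forall u v, `|K u - K v| <= L * `|u - v|.
Proof.
case: kernelK => _ _ _ [M [_ HM]] _; exists (`|M| + 1); first by rewrite ltr_wpDl.
have MM : M < `|M| + 1 by rewrite (le_lt_trans (ler_norm M))// ltrDl.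
by move=> u v; exact: (HM _ MM (u, v)).
Qed.

Lemma kernel_bounded : exists2 B, 0 < B & forall u, K u <= B.
Proof.
have [L L0 KL] := kernel_lipschitz.
exists (L * 3); first by rewrite mulr_gt0.
move=> u; have [u1|u1] := leP `|u| 1; last first.
  by rewrite kernel_out// mulr_ge0// ltW.
have := KL u 2; rewrite [K 2]kernel_out; last by rewrite ger0_norm// ltr1n.
rewrite subr0 ger0_norm ?kernel_ge0// => /le_trans; apply.
rewrite ler_pM2l// (le_trans (ler_normB _ _))//.
by rewrite [X in _ + X]ger0_norm//; lra.
Qed.

Lemma kernel_continuous : continuous K.
Proof.
by have [L L0 KL] := kernel_lipschitz; exact: lipschitz_continuous KL.
Qed.

Lemma rescaled_kernel_out x h u : 0 < h -> h < `|u - x| -> K ((u - x) / h) = 0.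
Proof.
move=> h0 hu; apply: kernel_out.
by rewrite normrM normfV (gtr0_norm h0) ltr_pdivlMr// mul1r.
Qed.

Let moment k u := u ^+ k * K u.

Let moment_continuous k : continuous (moment k).
Proof.
move=> u; rewrite /moment; apply: cvgM; last exact: kernel_continuous.
exact: exprn_continuous.
Qed.

Let moment_out k v : 1 < `|v| -> moment k v = 0.
Proof. by move=> v1; rewrite /moment kernel_out// mulr0. Qed.

Let kernel_mass : \int[mu]_u moment 0 u = 1.
Proof.
case: kernelK => _ K1 _ _ _; rewrite /Rintegral.
by under eq_integral do rewrite /moment expr0 mul1r; rewrite K1.
Qed.

Let kernel_mean : \int[mu]_u moment 1 u = 0.
Proof.
apply: integral_odd => //; first exact: moment_out.
by move=> v; rewrite /moment !expr1; case: kernelK => _ _ -> _ _; rewrite mulNr.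
Qed.

Let rescaled_moment x h k u : 0 < h ->
  K ((u - x) / h) * (u - x) ^+ k = h ^+ k * moment k ((u - x) / h).
Proof.
move=> h0; rewrite /moment exprMn exprVn mulrA mulrC [h ^+ k * _]mulrC mulfVK//.
by rewrite gt_eqF// exprn_gt0.
Qed.

Let integrable_moment x h k : 0 < h ->
  mu.-integrable setT (EFin \o (fun u => K ((u - x) / h) * (u - x) ^+ k)).
Proof.
move=> h0; under eq_fun do rewrite rescaled_moment//.
apply: integrable_scale; apply: (@integrable_compact_support _ _ (x - h) (x + h)).
  exact/continuous_rescale/moment_continuous.
by move=> u; apply: rescale_vanish => //; exact: moment_out.
Qed.

Let integral_moment x h k : 0 < h ->
  \int[mu]_u (K ((u - x) / h) * (u - x) ^+ k) = h ^+ k.+1 * \int[mu]_u moment k u.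
Proof.
move=> h0; under eq_Rintegral do rewrite rescaled_moment//.
rewrite RintegralZl//; last first.
  apply: (@integrable_compact_support _ _ (x - h) (x + h)).
    exact/continuous_rescale/moment_continuous.
  by move=> u; apply: rescale_vanish => //; exact: moment_out.
by rewrite integral_rescale//; [rewrite mulrA -exprSr|exact: moment_out].
Qed.

(** The odd moment vanishes by symmetry, so [c1] does not appear in the result.
    The error is multiplied by [h] only, the mass of the rescaled kernel, because
    the kernel is nonnegative.  This single estimate provides integrability,
    two-sided bounds (take [c1 = c2 = 0] and the middle of the range of [psi])
    and asymptotic expansions. *)
Lemma kernel_integral_approx (psi : R -> R) (x h c0 c1 c2 e : R) :
  0 < h -> measurable_fun setT psi ->
  (forall u, `|u - x| <= h ->
     `|psi u - (c0 + c1 * (u - x) + c2 * (u - x) ^+ 2)| <= e) ->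
  mu.-integrable setT (EFin \o (fun u => K ((u - x) / h) * psi u)) /\
  `|\int[mu]_u (K ((u - x) / h) * psi u) -
     (c0 * h + c2 * h ^+ 3 * \int[mu]_u (u ^+ 2 * K u))| <= e * h.
Proof.
move=> h0 mpsi psie.
pose m k u := K ((u - x) / h) * (u - x) ^+ k.
pose p u := (c0 * m 0%N u + c1 * m 1%N u) + c2 * m 2%N u.
have im k := integrable_moment x k h0.
have ip : mu.-integrable setT (EFin \o p).
  by apply: integrable_add; [apply: integrable_add|]; apply: integrable_scale; exact: im.
have Ip : \int[mu]_u p u = c0 * h + c2 * h ^+ 3 * \int[mu]_u (u ^+ 2 * K u).
  have i0 := integrable_scale c0 (im 0%N).
  have i1 := integrable_scale c1 (im 1%N).
  have i2 := integrable_scale c2 (im 2%N).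
  rewrite /p RintegralD//; last exact: integrable_add.
  rewrite RintegralD// !RintegralZl//; [|exact: im..].
  rewrite /m !integral_moment// kernel_mass kernel_mean expr1.
  by rewrite /moment; ring.
pose q u := K ((u - x) / h) * psi u - p u.
have qE u : q u = K ((u - x) / h) * (psi u - (c0 + c1 * (u - x) + c2 * (u - x) ^+ 2)).
  by rewrite /q /p /m; ring.
have qle u : `|q u| <= e * m 0%N u.
  rewrite qE /m expr0 mulr1 normrM (ger0_norm (kernel_ge0 _)).
  have [uh|uh] := leP `|u - x| h; last by rewrite rescaled_kernel_out// !(mul0r, mulr0).
  by rewrite mulrC ler_wpM2r// ?kernel_ge0// psie.
have mq : measurable_fun setT q.
  apply: measurable_funB.
    apply: measurable_funM => //; apply: continuous_measurable_fun.
    exact/continuous_rescale/kernel_continuous.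
  by apply/measurable_EFinP; exact: (measurable_int mu ip).
have iem := integrable_scale e (im 0%N).
have iq : mu.-integrable setT (EFin \o q).
  apply: le_integrable iem => //; first exact/measurable_EFinP.
  by move=> u _; rewrite lee_fin (le_trans (qle u))// ler_norm.
have ipsi := integrable_add iq ip.
have psiE : (fun u => q u + p u) = (fun u => K ((u - x) / h) * psi u).
  by apply/funext => u; rewrite /q subrK.
rewrite psiE in ipsi; split => //.
rewrite -psiE RintegralD// Ip addrK.
apply: le_trans (le_normr_Rintegral measurableT iq) _.
apply: (@le_trans _ _ (\int[mu]_u (e * m 0%N u))).
  by apply: le_Rintegral => //; exact: integrable_norm iq.
rewrite RintegralZl//; last exact: im.
by rewrite /m integral_moment// kernel_mass expr1 mulr1.
Qed.

End kernel.

(** * The law of the design *)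

Section sample.
Context d (T : measurableType d) (R : realType) (P : probability T R).
Notation mu := (@lebesgue_measure R).

Lemma iid_marginal (Xs Ys : nat -> {RV P >-> R}) (X Y : {RV P >-> R}) (f : R -> R) :
  iid_copies Xs Ys X Y -> has_density X f ->
  mutually_independent P (fun i w => Xs i w) /\ forall i, has_density (Xs i) f.
Proof.
move=> [ind law] [mf f0 fX]; split=> [J B uJ mB|i]; last first.
  split => // B mB; rewrite -fX//.
  have := law i (B `*` setT) (measurableX mB measurableT).
  suff H (V W : T -> R) : (fun w => (V w, W w)) @^-1` (B `*` setT) = V @^-1` B.
    by rewrite !H.
  by apply/seteqP; split => w /=; [case|split].
have mB' i : measurable (B i `*` (setT : set R)) by exact: measurableX.
have := ind J _ uJ mB'.
have -> : [set w | forall i, i \in J -> (B i `*` setT) (Xs i w, Ys i w)] =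
          [set w | forall i, i \in J -> B i (Xs i w)].
  by apply/seteqP; split => w /= H i /H; [case|split].
move=> ->; apply: eq_bigr => i _; congr (P _).
by apply/seteqP; split => w /=; [case|split].
Qed.

(** Adding the bound [A] to [psi] reduces the claim to nonnegative functions. *)
Lemma expectation_density (X : {RV P >-> R}) (f psi : R -> R) (A : R) :
  has_density X f -> measurable_fun setT psi -> (forall u, `|psi u| <= A) ->
  \int[P]_w psi (X w) = \int[mu]_u (psi u * f u).
Proof.
move=> [mf f0 fX] mpsi psiA.
have ge0E (phi : R -> R) : measurable_fun setT phi -> (forall u, 0 <= phi u) ->
    (\int[P]_w (phi (X w))%:E = \int[mu]_u (phi u * f u)%:E)%E.
  move=> mphi phi0.
  rewrite -(@ge0_integral_density _ _ _ _ R mu (distribution P X) id f)//.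
  rewrite ge0_integral_distribution//; exact/measurable_EFinP.
have intE (phi : R -> R) : measurable_fun setT phi -> (forall u, 0 <= phi u) ->
    (forall u, phi u <= A + A) ->
    mu.-integrable setT (EFin \o (fun u => phi u * f u)).
  move=> mphi phi0 phiA; apply/integrableP; split.
    by apply/measurable_EFinP; exact: measurable_funM.
  under eq_integral => u _.
    rewrite /= ger0_norm; last by rewrite mulr_ge0.
    over.
  rewrite -ge0E//.
  have iphi : P.-integrable setT (EFin \o (fun w => phi (X w))).
    apply: (@bounded_integrable _ _ _ _ _ (A + A)); first exact: measurableT_comp.
    by move=> w; rewrite ger0_norm.
  rewrite -ge0_fin_numE ?integral_ge0// => [|w _]; last by rewrite lee_fin.
  exact: (integrable_fin_num _ iphi).
have A0 : 0 <= A by apply: le_trans (psiA 0).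
have psiA' u : - A <= psi u <= A by rewrite -ler_norml.
have mpsiA : measurable_fun setT (fun u => psi u + A) by exact: measurable_funD.
have p0 u : 0 <= psi u + A by have := psiA' u; lra.
have pA u : psi u + A <= A + A by have := psiA' u; lra.
have i1 := intE _ mpsiA p0 pA.
have AA : A <= A + A by rewrite lerDl.
have i2 := intE (fun=> A) (measurable_cst _) (fun=> A0) (fun=> AA).
have j1 : P.-integrable setT (EFin \o (fun w => psi (X w) + A)).
  apply: (@bounded_integrable _ _ _ _ _ (A + A)).
    by apply: measurable_funD => //; exact: measurableT_comp.
  by move=> w; rewrite ger0_norm.
have j2 : P.-integrable setT (EFin \o (fun w : T => A)).
  exact: finite_measure_integrable_cst.
transitivity (\int[P]_w ((psi (X w) + A) - A)).
  by apply: eq_Rintegral => w _; rewrite addrK.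
rewrite RintegralB// /Rintegral (ge0E _ mpsiA p0).
rewrite (ge0E (fun=> A) (measurable_cst _) (fun=> A0)).
rewrite -/(Rintegral mu setT (fun u => (psi u + A) * f u)).
rewrite -/(Rintegral mu setT (fun u => A * f u)) -RintegralB//.
by apply: eq_Rintegral => u _; ring.
Qed.

End sample.

(** * Equicontinuous sequences of functions on the unit interval *)

Section equicontinuity.
Context (R : realType).
Implicit Types (g : nat -> R -> R).

Lemma equicontinuous_near (A : set R) g : asymptotically_equicontinuous A g ->
  forall e, 0 < e -> exists2 del, 0 < del & \forall n \near \oo,
    forall u v, A u -> A v -> `|u - v| <= del -> `|g n u - g n v| <= e.
Proof.
move=> H e e0.
have nbh : nbhs (0%E : \bar R) [set y | (y < e%:E)%E].
  by apply: open_nbhs_nbhs; split; [exact: open_ereal_lt_ereal|rewrite /= lte_fin].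
have /= := H _ nbh; rewrite /nbhs/= => -[r /= r0 Hr].
have r2 : 0 < r / 2 by rewrite divr_gt0.
exists (r / 2) => //.
have : ball 0 r (r / 2).
  by rewrite /ball/= sub0r normrN gtr0_norm// ltr_pdivrMr// ltr_pMr// ltr1n.
move=> /Hr /(_ r2) /= /ereal_inf_lt[_ [V Voo <-]] HV.
near=> n => u v Au Av uv; have Vn : V n by near: n.
rewrite -lee_fin; apply: le_trans (ltW HV).
apply: le_trans (ereal_sup_ubound (ex_intro2 _ _ n Vn erefl)).
by apply: ereal_sup_ubound; exists (u, v).
Unshelve. all: by end_near. Qed.

Lemma mean_value_01 (F dF : R -> R) (u v : R) :
  u \in `]0, 1[ -> v \in `]0, 1[ ->
  {in `]0, 1[, forall x : R, is_derive x 1 F (dF x)} ->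
  exists c, [/\ c \in `]0, 1[, `|c - u| <= `|v - u| & F v - F u = dF c * (v - u)].
Proof.
move=> u01 v01 derF.
have cF a b : a \in `]0, 1[ -> b \in `]0, 1[ -> {within `[a, b], continuous F}.
  move=> a01 b01; apply: derivable_within_continuous => x xab.
  have x01 : x \in `]0, 1[ by move: a01 b01 xab; rewrite !in_itv/=; lra.
  by have := derF x x01; move=> [].
have main a b : a \in `]0, 1[ -> b \in `]0, 1[ -> a < b ->
    exists c, [/\ c \in `]0, 1[, a <= c <= b & F b - F a = dF c * (b - a)].
  move=> a01 b01 ab.
  have dab x : x \in `]a, b[ -> is_derive x 1 F (dF x).
    by move=> xab; apply: derF; move: a01 b01 xab; rewrite !in_itv/=; lra.
  have [c cab E] := MVT ab dab (cF _ _ a01 b01).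
  exists c; split => //; move: a01 b01 cab; rewrite !in_itv/=; lra.
have [uv|vu|<-] := ltgtP u v.
- have [c [c01 /andP[uc cv] E]] := main u v u01 v01 uv; exists c; split => //.
  by rewrite !ger0_norm ?lerD2r ?subr_ge0// ltW.
- have [c [c01 /andP[vc cu] E]] := main v u v01 u01 vu; exists c; split => //.
    by rewrite !ler0_norm ?lerN2 ?lerD2r ?subr_le0// ltW.
  by rewrite -opprB E -mulrN opprB.
- by exists u; rewrite !subrr mulr0.
Qed.

(** A large derivative at one point stays large on a neighbourhood of fixed size,
    by equicontinuity of the derivatives, and hence makes the function itself
    vary by more than equicontinuity allows. *)
Lemma derive_bounded_near g :
  asymptotically_equicontinuous `]0, 1[ g ->
  asymptotically_equicontinuous `]0, 1[ (fun n => (g n)^`()%classic) ->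
  (forall n, {in `]0, 1[, forall x : R, derivable (g n) x 1}) ->
  exists2 C, 0 < C & \forall n \near \oo,
    forall u, u \in `]0, 1[ -> `|(g n)^`()%classic u| <= C.
Proof.
move=> eg eg' dg.
have [d0 d00 near0] := equicontinuous_near eg ltr01.
have [d1 d10 near1] := equicontinuous_near eg' ltr01.
(* with [del <= 1 / 4], either [u + del] or [u - del] stays in the interval *)
pose del := Num.min (1 / 4) (Num.min d0 d1).
have del0 : 0 < del by rewrite !lt_min d00 d10 andbT; lra.
have del4 : del <= 1 / 4 by rewrite /del ge_min lexx.
have dd0 : del <= d0 by rewrite /del !ge_min lexx !orbT.
have dd1 : del <= d1 by rewrite /del !ge_min lexx !orbT.
exists (del^-1 + 1); first by rewrite ltr_wpDl// invr_ge0 ltW.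
near=> n => u u01.
have [v v01 vu] : exists2 v, v \in `]0, 1[ & `|v - u| = del.
  have [u2|u2] := leP u (1 / 2).
    exists (u + del); last by rewrite addrC addKr gtr0_norm.
    by move: u01; rewrite !in_itv/=; lra.
  exists (u - del); last by rewrite addrC addKr normrN gtr0_norm.
  by move: u01; rewrite !in_itv/=; lra.
have [|c [c01 cu E]] := @mean_value_01 (g n) (g n)^`()%classic u v u01 v01.
  by move=> x x01; rewrite derive1E; apply: DeriveDef => //; exact: dg.
have H0 : `|g n v - g n u| <= 1.
  suff : forall u v, u \in `]0, 1[ -> v \in `]0, 1[ -> `|u - v| <= d0 ->
    `|g n u - g n v| <= 1 by apply => //; rewrite vu.
  by near: n.
have H1 : `|(g n)^`()%classic u - (g n)^`()%classic c| <= 1.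
  suff : forall u v, u \in `]0, 1[ -> v \in `]0, 1[ -> `|u - v| <= d1 ->
    `|(g n)^`()%classic u - (g n)^`()%classic v| <= 1.
    by apply => //; rewrite distrC (le_trans cu)// vu.
  by near: n.
have H2 : `|(g n)^`()%classic c| <= del^-1.
  by move: H0; rewrite E normrM vu -ler_pdivlMr// mul1r.
rewrite -[_ u](subrK ((g n)^`()%classic c)) addrC (le_trans (ler_normD _ _))//.
by rewrite lerD.
Unshelve. all: by end_near. Qed.

(** Two applications of the mean value theorem, so that the oscillation of the
    second derivative is the only regularity used. *)
Lemma taylor2_01 (g : R -> R) (x u w : R) :
  {in `]0, 1[, forall x : R, derivable g x 1 /\ derivable g^`()%classic x 1} ->
  x \in `]0, 1[ -> u \in `]0, 1[ ->
  (forall v, v \in `]0, 1[ -> `|v - x| <= `|u - x| ->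
     `|g^`(2)%classic v - g^`(2)%classic x| <= w) ->
  `|g u - g x - g^`()%classic x * (u - x) - g^`(2)%classic x / 2 * (u - x) ^+ 2|
    <= w * (u - x) ^+ 2.
Proof.
move=> dg x01 u01 gw.
have dg1 (y : R) : y \in `]0, 1[ -> is_derive y 1 g (g^`()%classic y).
  by move=> y01; rewrite derive1E; apply: DeriveDef => //; exact: (dg y y01).1.
have dg2 (y : R) : y \in `]0, 1[ -> is_derive y 1 g^`()%classic (g^`(2)%classic y).
  by move=> y01; apply: DeriveDef; [exact: (dg y y01).2|by rewrite -derive1E].
pose a1 := g^`()%classic x; pose a2 := g^`(2)%classic x.
pose D (t : R) := g t - a1 * (t - x) - a2 / 2 * (t - x) ^+ 2.
pose dD (t : R) := g^`()%classic t - a1 - a2 * (t - x).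
have derD (y : R) : y \in `]0, 1[ -> is_derive y 1 D (dD y).
  move=> y01; have := dg1 y y01 => ?; rewrite /D.
  apply: is_derive_eq; rewrite /dD /GRing.scale/=.
  by field.
have [c [c01 cx E]] := @mean_value_01 D dD x u x01 u01 derD.
have [c' [c'01 c'x E']] := @mean_value_01 _ _ x c x01 c01 dg2.
have Dx : D x = g x by rewrite /D subrr mulr0 expr0n/= mulr0 !subr0.
rewrite (_ : _ - _ = D u - D x); last by rewrite Dx /D /a1 /a2; ring.
rewrite E (_ : dD c = (g^`(2)%classic c' - a2) * (c - x)); last first.
  by rewrite mulrBl; congr (_ - _); exact: E'.
rewrite !normrM -[X in _ <= _ * X]real_normK ?num_real// expr2 mulrA.
rewrite ler_wpM2r// ler_pM// gw//.
by rewrite (le_trans c'x).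
Qed.

End equicontinuity.

(** * Uniform approximation of the Nadaraya-Watson smoother *)

Section smoother.
Context (R : realType).
Notation mu := (@lebesgue_measure R).

(** The bias at [x] of the Nadaraya-Watson smoother of [a] when the sample is
    replaced by a population of density [f]. *)
Definition nw_bias (K f : R -> R) (h : R) (a : R -> R) (x : R) : R :=
  (\int[mu]_u (K ((u - x) / h) * ((a u - a x) * f u))) /
  (\int[mu]_u (K ((u - x) / h) * f u)).

Lemma sum_nw_weight (K : R -> R) (h : R) n (t : 'I_n -> R) (x : R) (phi : 'I_n -> R) :
  0 < h ->
  \sum_(i < n) nw_weight K h t i x * phi i =
  (\sum_(i < n) K ((t i - x) / h) * phi i) / (\sum_(i < n) K ((t i - x) / h)).
Proof.
move=> h0; rewrite mulr_suml; apply: eq_bigr => i _.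
rewrite /nw_weight /rescaled -mulr_suml.
rewrite [in RHS]mulrAC; congr (_ * _).
by rewrite invfM invrK mulrACA mulVf ?mulr1 ?gt_eqF.
Qed.

End smoother.

Section bigO_p.
Context d (T : measurableType d) (R : realType) (P : probability T R).

Lemma outer_probU2 (A B : set T) :
  ((P^*)%mu (A `|` B) <= (P^*)%mu A + (P^*)%mu B)%E.
Proof. exact: outer_measureU2. Qed.

(** Arguing on the event where all the stochastic bounds hold, up to a null set. *)
Lemma bigO_p_combine (Q : nat -> set T) (Z1 Z2 Z : nat -> T -> \bar R)
    (a : nat -> R) :
  bigO_p P Z1 a -> bigO_p P Z2 a ->
  (\forall n \near \oo, {ae P, forall w, Q n w}) ->
  (forall M1 M2, 0 < M1 -> 0 < M2 -> exists2 M, 0 < M & \forall n \near \oo,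
     forall w, Q n w -> (Z1 n w <= (M1 * a n)%:E)%E ->
       (Z2 n w <= (M2 * a n)%:E)%E -> (Z n w <= (M * a n)%:E)%E) ->
  bigO_p P Z a.
Proof.
move=> O1 O2 aeQ ZM eta eta0.
have eta2 : 0 < eta / 2 by rewrite divr_gt0.
have [M1 M10 near1] := O1 _ eta2; have [M2 M20 near2] := O2 _ eta2.
have [M M0 nearM] := ZM _ _ M10 M20.
exists M => //; near=> n.
have : {ae P, forall w, Q n w} by near: n.
move=> [N [mN PN QN]].
have QM : forall w, Q n w -> (Z1 n w <= (M1 * a n)%:E)%E ->
       (Z2 n w <= (M2 * a n)%:E)%E -> (Z n w <= (M * a n)%:E)%E by near: n.
have H1 : ((P^*)%mu [set w | (M1 * a n)%:E < Z1 n w] <= (eta / 2)%:E)%E by near: n.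
have H2 : ((P^*)%mu [set w | (M2 * a n)%:E < Z2 n w] <= (eta / 2)%:E)%E by near: n.
apply: (@le_trans _ _ ((P^*)%mu (([set w | ((M1 * a n)%:E < Z1 n w)%E] `|`
   [set w | ((M2 * a n)%:E < Z2 n w)%E]) `|` N))).
  apply: le_outer_prob => w /= Zw; apply: contrapT => /not_orP[/not_orP[]].
  move=> /negP; rewrite -leNgt => z1 /negP; rewrite -leNgt => z2 Nw.
  move: Zw; apply/negP; rewrite -leNgt; apply: QM => //.
  by apply: contrapT => Qw; apply: Nw; apply: QN.
apply: le_trans (outer_probU2 _ _) _.
have -> : (P^*)%mu N = 0%E by rewrite measurable_mu_extE.
rewrite adde0; apply: le_trans (outer_probU2 _ _) _.
by rewrite [leRHS](_ : _ = (eta / 2)%:E + (eta / 2)%:E)%E ?leeD// -EFinD -splitr.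
Unshelve. all: by end_near. Qed.

End bigO_p.

Lemma near_bandwidth_le (R : realType) (h : nat -> R) (e : R) :
  h n @[n --> \oo] --> 0 -> 0 < e -> \forall n \near \oo, h n <= e.
Proof.
move=> /cvgrPdist_le h0 e0; near=> n; rewrite (le_trans (ler_norm _))//.
by rewrite -normrN -sub0r; near: n; exact: h0.
Unshelve. all: by end_near. Qed.

Section smoother_deviation.
Context d (T : measurableType d) (R : realType) (P : probability T R).
Notation mu := (@lebesgue_measure R).
Context (Xs : nat -> {RV P >-> R}) (f K : R -> R) (h : nat -> R).
Hypotheses (indX : mutually_independent P (fun i w => Xs i w))
  (fX : forall i, has_density (Xs i) f) (kernelK : kernel_function K)
  (h_gt0 : forall n, 0 < h n) (h_cvg0 : h n @[n --> \oo] --> 0)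
  (nh_cvgy : n%:R * h n / ln n%:R @[n --> \oo] --> +oo).

(** With S1 and S2 the empirical means of K((X_i - x) / h) and of
    K((X_i - x) / h) (a(X_i) - a(x)) / h, and D and E2 their expectations, the
    error is h (S2 / S1 - E2 / D).  [uniform_deviation] controls S1 - D and
    S2 - E2 by [rate], while S1 and D are of order h and |E2| <= C D; the
    factor h in front compensates the division by S1. *)
Lemma nw_smoother_deviation (p q del c F C : R) (a : nat -> R -> R) :
  p <= q -> q - p <= 1 -> 0 < del -> 0 < c -> 0 < C ->
  (forall u, u \in `[p - del, q + del] -> c <= f u <= F) ->
  (\forall n \near \oo, forall u v, `|a n u - a n v| <= C * `|u - v|) ->
  bigO_p P (fun n w => ereal_sup
    [set `|\sum_(i < n) nw_weight K (h n) (design Xs w) i x * a n (Xs i w)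
           - a n x - nw_bias K f (h n) (a n) x|%:E | x in `[p, q]]) (rate h).
Proof.
move=> pq qp1 del0 c0 C0 fcF nearC.
have [Lk Lk0 KL] := kernel_lipschitz kernelK.
have [B B0 KB] := kernel_bounded kernelK.
have mf : measurable_fun setT f by have [] := fX 0%N.
have cF : c <= F.
  have /fcF /andP[cf fF] : p \in `[p - del, q + del] by rewrite in_itv/=; lra.
  exact: le_trans cf fF.
have F0 : 0 < F by rewrite (lt_le_trans c0).
pose D n x := \int[mu]_u (K ((u - x) / h n) * f u).
pose G1 n x u := K ((u - x) / h n).
pose G2 n x u := K ((u - x) / h n) * ((a n u - a n x) / h n).
pose E2 n x := \int[P]_w G2 n x (Xs 0%N w).
have mG1 n x : measurable_fun setT (G1 n x).
  apply: continuous_measurable_fun; apply: continuous_rescale.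
  exact: kernel_continuous.
have G1B n x u : `|G1 n x u| <= B by rewrite ger0_norm ?KB// (kernel_ge0 kernelK).
have G1D n x i : \int[P]_w G1 n x (Xs i w) = D n x.
  exact: (@expectation_density _ _ _ P (Xs i) f (G1 n x) B (fX i) (mG1 n x) (G1B n x)).
have iG1 n x i : P.-integrable setT (EFin \o (fun w => G1 n x (Xs i w))).
  apply: (@bounded_integrable _ _ _ _ _ B); first exact: measurableT_comp.
  by move=> w; exact: G1B.
have nearD : \forall n \near \oo, forall x, x \in `[p, q] ->
    c * h n <= D n x <= F * h n.
  near=> n => x; rewrite in_itv/= => /andP[px xq].
  have hdel : h n <= del by near: n; exact: near_bandwidth_le.
  have [|_] := @kernel_integral_approx _ _ kernelK f x (h n)
    ((c + F) / 2) 0 0 ((F - c) / 2) (h_gt0 n) mf.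
    move=> u; rewrite ler_distl => /andP[xu ux].
    have /fcF/andP[cu uF] : u \in `[p - del, q + del] by rewrite in_itv/=; lra.
    by rewrite !mul0r !addr0 ler_distl; lra.
  rewrite !mul0r addr0 ler_distl -/(D n x) => /andP[].
  by have := h_gt0 n; lra.
have invh : \forall n \near \oo, (h n)^-1 <= n%:R ^+ 2.
  near=> n; have nh1 : 1 <= n%:R * h n by near: n; exact: near_nh_ge1.
  have n1 : 1 <= n%:R :> R by rewrite ler1n; near: n; exact: nbhs_infty_gt.
  rewrite -[leLHS]mul1r ler_pdivrMr ?h_gt0// (le_trans nh1)//.
  by rewrite ler_pM2r ?h_gt0// expr2 ler_peMr.
have nearG2 : \forall n \near \oo, forall x u, `|G2 n x u| <= C * G1 n x u.
  near=> n => x u.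
  have aC : forall u v, `|a n u - a n v| <= C * `|u - v| by near: n.
  have K0 : 0 <= K ((u - x) / h n) by exact: (kernel_ge0 kernelK).
  rewrite /G2 /G1 normrM ger0_norm// mulrC.
  have [uh|uh] := leP `|u - x| (h n); last first.
    by rewrite (rescaled_kernel_out kernelK)// !mulr0.
  rewrite ler_wpM2r// normrM normfV (gtr0_norm (h_gt0 n)) ler_pdivrMr ?h_gt0//.
  by rewrite (le_trans (aC _ _))// ler_pM2l.
have iG1sq n x i : P.-integrable setT (EFin \o (fun w => G1 n x (Xs i w) ^+ 2)).
  apply: (@bounded_integrable _ _ _ _ _ (B ^+ 2)).
    by apply: measurable_funX; exact: measurableT_comp.
  by move=> w; rewrite normrX ler_pXn2r// nnegrE// ltW.
have nearG1sq : \forall n \near \oo, forall x, x \in `[p, q] -> forall i,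
    \int[P]_w G1 n x (Xs i w) ^+ 2 <= B * F * h n.
  near=> n => x xpq i.
  have /(_ x xpq)/andP[_ DF] : forall x, x \in `[p, q] -> c * h n <= D n x <= F * h n.
    by near: n.
  rewrite -mulrA (le_trans _ (_ : B * D n x <= _)) ?ler_pM2l//.
  rewrite -(G1D n x i) -RintegralZl//; apply: le_Rintegral => //.
  - exact: integrable_scale.
  - by move=> w _; rewrite expr2 ler_wpM2r ?KB// (kernel_ge0 kernelK).
have O1 : bigO_p P (fun n w => ereal_sup
    [set `|n%:R^-1 * \sum_(i < n) G1 n x (Xs i w) - D n x|%:E | x in `[p, q]]) (rate h).
  apply: (@uniform_deviation _ _ _ P h Xs h_gt0 nh_cvgy indX p q B (B * F) Lk) => //.
  - by rewrite mulr_ge0// ltW.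
  - exact: ltW.
  - near=> n => x xpq; split => //.
      by move: x xpq; near: n; exact: nearG1sq.
  - near=> n => x y u _ _.
    have hn2 : (h n)^-1 <= n%:R ^+ 2 by near: n.
    rewrite (le_trans (KL _ _))// -mulrA ler_pM2l// -mulrBl opprB addrC addrA subrK.
    by rewrite normrM normfV (gtr0_norm (h_gt0 n)) distrC mulrC ler_wpM2r.
have nearmG2 : \forall n \near \oo, forall x, measurable_fun setT (G2 n x).
  near=> n => x.
  have aC : forall u v, `|a n u - a n v| <= C * `|u - v| by near: n.
  apply: measurable_funM; first exact: mG1.
  apply: measurable_funM => //; apply: measurable_funB => //.
  by apply: continuous_measurable_fun; exact: lipschitz_continuous aC.
have O2 : bigO_p P (fun n w => ereal_sup
    [set `|n%:R^-1 * \sum_(i < n) G2 n x (Xs i w) - E2 n x|%:E | x in `[p, q]]) (rate h).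
  apply: (@uniform_deviation _ _ _ P h Xs h_gt0 nh_cvgy indX p q
    (C * B) (C ^+ 2 * (B * F)) (C * (Lk + B))) => //.
  - by rewrite mulr_gt0.
  - by rewrite mulr_ge0 ?exprn_ge0 ?mulr_ge0// ltW.
  - by rewrite mulr_ge0 ?addr_ge0// ltW.
  - near=> n => x xpq.
    have mG2 : measurable_fun setT (G2 n x) by move: x {xpq}; near: n.
    have G2G1 : forall u, `|G2 n x u| <= C * G1 n x u by move: x {xpq mG2}; near: n.
    have G2B u : `|G2 n x u| <= C * B by rewrite (le_trans (G2G1 _))// ler_pM2l ?KB.
    split => // i.
      rewrite /E2 (expectation_density (fX i) mG2 G2B).
      by rewrite (expectation_density (fX 0%N) mG2 G2B).
    apply: (@le_trans _ _ (C ^+ 2 * \int[P]_w G1 n x (Xs i w) ^+ 2)); last first.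
      rewrite -mulrA ler_pM2l ?exprn_gt0//; move: i; move: x xpq {mG2 G2G1 G2B}; near: n.
      exact: nearG1sq.
    rewrite -RintegralZl//; apply: le_Rintegral => //.
    - apply: (@bounded_integrable _ _ _ _ _ ((C * B) ^+ 2)).
        by apply: measurable_funX; exact: measurableT_comp.
      by move=> w; rewrite normrX ler_pXn2r// nnegrE ?normr_ge0// mulr_ge0// ltW.
    - exact: integrable_scale.
    - move=> w _; rewrite -exprMn -real_normK ?num_real// ler_pXn2r// nnegrE//.
      by rewrite mulr_ge0 ?(kernel_ge0 kernelK)// ltW.
  - near=> n => x y u _ _.
    have hn := h_gt0 n.
    have hn2 : (h n)^-1 <= n%:R ^+ 2 by near: n.
    have aC : forall u v, `|a n u - a n v| <= C * `|u - v| by near: n.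
    have main s t : `|u - s| <= h n ->
        `|G2 n s u - G2 n t u| <= C * (Lk + B) * (h n)^-1 * `|s - t|.
      move=> us.
      rewrite (_ : _ - _ =
          (K ((u - s) / h n) - K ((u - t) / h n)) * ((a n u - a n s) / h n) + K ((u - t) / h n) * ((a n t - a n s) / h n)); last first.
        by rewrite /G2; ring.
      apply: (@le_trans _ _ (Lk * (h n)^-1 * `|s - t| * C + B * (C * `|s - t| / h n))).
        apply: le_trans (ler_normD _ _) _; apply: lerD; rewrite normrM.
          apply: ler_pM => //.
            rewrite (le_trans (KL _ _))// -mulrA ler_pM2l// -mulrBl opprB addrC addrA subrK.
            by rewrite normrM normfV (gtr0_norm hn) distrC mulrC.
          rewrite normrM normfV (gtr0_norm hn) ler_pdivrMr//.
          by rewrite (le_trans (aC _ _))// ler_pM2l.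
        apply: ler_pM => //; first by rewrite ger0_norm ?KB// (kernel_ge0 kernelK).
        rewrite normrM normfV (gtr0_norm hn) ler_pM2r ?invr_gt0//.
        by rewrite (le_trans (aC _ _))// distrC.
      by rewrite le_eqVlt; apply/orP; left; apply/eqP; ring.
    apply: (@le_trans _ _ (C * (Lk + B) * (h n)^-1 * `|x - y|)); last first.
      by rewrite ler_wpM2r// ler_pM2l// mulr_gt0// addr_gt0.
    have [ux|ux] := leP `|u - x| (h n); first exact: main.
    have [uy|uy] := leP `|u - y| (h n).
      by rewrite distrC [`|x - y|]distrC; exact: main.
    rewrite /G2 !(rescaled_kernel_out kernelK)// !mul0r subrr normr0.
    by rewrite !mulr_ge0// ?invr_ge0 ?addr_ge0// ltW.
apply: (bigO_p_combine (Q := fun=> setT) O1 O2); first by near=> n; exact: aeW.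
move=> M1 M2 M10 M20; exists (2 * (M2 + C * M1) / c).
  by rewrite divr_gt0// mulr_gt0// addr_gt0// mulr_gt0.
near=> n => w _ Z1 Z2.
apply: ge_ereal_sup => _ [x xpq <-]; rewrite lee_fin.
have {}xpq : x \in `[p, q] by [].
have hn := h_gt0 n.
have n0 : (0 < n)%N by near: n; exact: nbhs_infty_gt.
have {}Z1 : `|n%:R^-1 * \sum_(i < n) G1 n x (Xs i w) - D n x| <= M1 * rate h n.
  by rewrite -lee_fin; apply: le_trans Z1; apply: ereal_sup_ubound; exists x.
have {}Z2 : `|n%:R^-1 * \sum_(i < n) G2 n x (Xs i w) - E2 n x| <= M2 * rate h n.
  by rewrite -lee_fin; apply: le_trans Z2; apply: ereal_sup_ubound; exists x.
have /(_ x xpq)/andP[cD _] : forall x, x \in `[p, q] -> c * h n <= D n x <= F * h n.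
  by near: n.
have rh : rate h n <= c / (2 * M1) * h n.
  by near: n; apply: near_rate_le => //; rewrite divr_gt0// mulr_gt0.
have aC : forall u v, `|a n u - a n v| <= C * `|u - v| by near: n.
have mG2 : measurable_fun setT (G2 n x) by move: x {xpq Z1 Z2 cD}; near: n.
have G2G1 : forall u, `|G2 n x u| <= C * G1 n x u by move: x {xpq Z1 Z2 cD mG2}; near: n.
have G2B u : `|G2 n x u| <= C * B by rewrite (le_trans (G2G1 _))// ler_pM2l ?KB.
have D0 : 0 < D n x by rewrite (lt_le_trans _ cD)// mulr_gt0.
have E2D : `|E2 n x| <= C * D n x.
  have iG2 : P.-integrable setT (EFin \o (fun w => G2 n x (Xs 0%N w))).
    apply: (@bounded_integrable _ _ _ _ _ (C * B)); first exact: measurableT_comp.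
    by move=> ?; exact: G2B.
  apply: le_trans (le_normr_Rintegral measurableT iG2) _.
  rewrite -(G1D n x 0%N) -RintegralZl//; apply: le_Rintegral => //.
  - exact: integrable_norm iG2.
  - exact: integrable_scale.
have biasE : nw_bias K f (h n) (a n) x = h n * E2 n x / D n x.
  rewrite /nw_bias -/(D n x); congr (_ / _).
  rewrite /E2 (expectation_density (fX 0%N) mG2 G2B).
  have hdel : h n <= del by near: n; exact: near_bandwidth_le.
  have mpsi : measurable_fun setT (fun u => (a n u - a n x) * f u).
    apply: measurable_funM => //; apply: measurable_funB => //.
    by apply: continuous_measurable_fun; exact: lipschitz_continuous aC.
  have [|ipsi _] := @kernel_integral_approx _ _ kernelK _ x (h n)
    0 0 0 (C * h n * F) hn mpsi.
    move=> u ux; rewrite !mul0r !addr0 subr0 normrM.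
    have /fcF/andP[cu uF] : u \in `[p - del, q + del].
      by move: xpq ux; rewrite !in_itv/= ler_distl; lra.
    apply: ler_pM => //; first by rewrite (le_trans (aC _ _))// ler_pM2l.
    by rewrite ger0_norm// (le_trans (ltW c0)).
  rewrite [X in _ = _ * X](_ : _ = (h n)^-1 *
      \int[mu]_u (K ((u - x) / h n) * ((a n u - a n x) * f u))).
    by rewrite mulVKf// gt_eqF.
  rewrite -RintegralZl//; apply: eq_Rintegral => u _.
  by rewrite /G2; ring.
set S1 := n%:R^-1 * _ in Z1; set S2 := n%:R^-1 * _ in Z2.
have S1lb : c / 2 * h n <= S1.
  move: Z1; rewrite ler_distl => /andP[+ _].
  have : M1 * rate h n <= c / 2 * h n.
    rewrite (_ : c / 2 * h n = M1 * (c / (2 * M1) * h n)) ?ler_pM2l//.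
    by field; rewrite gt_eqF.
  lra.
have S10 : 0 < S1 by rewrite (lt_le_trans _ S1lb)// mulr_gt0// divr_gt0.
have sumE : \sum_(i < n) nw_weight K (h n) (design Xs w) i x * a n (Xs i w) - a n x =
    h n * S2 / S1.
  rewrite sum_nw_weight//.
  have SE : \sum_(i < n) K ((design Xs w i - x) / h n) = n%:R * S1.
    by rewrite /S1 mulVKf ?pnatr_eq0 -?lt0n.
  have -> : \sum_(i < n) K ((design Xs w i - x) / h n) * a n (Xs i w) =
      n%:R * (h n * S2 + a n x * S1).
    rewrite mulrDr mulrCA (_ : n%:R * S2 = \sum_(i < n) G2 n x (Xs i w)); last first.
      by rewrite /S2 mulVKf ?pnatr_eq0 -?lt0n.
    rewrite mulrCA -SE !mulr_sumr -big_split/=; apply: eq_bigr => i _.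
    by rewrite /G2 /design; field; rewrite gt_eqF.
  by rewrite SE; field; rewrite !gt_eqF ?ltr0n.
rewrite sumE biasE.
rewrite (_ : _ - _ = h n * ((S2 - E2 n x) + E2 n x / D n x * (D n x - S1)) / S1); last first.
  by field; rewrite !gt_eqF.
rewrite normrM normfV (gtr0_norm S10) normrM (gtr0_norm hn) ler_pdivrMr//.
apply: (@le_trans _ _ (h n * ((M2 + C * M1) * rate h n))).
  rewrite ler_pM2l// (le_trans (ler_normD _ _))// mulrDl lerD//.
  rewrite normrM -mulrA distrC ler_pM// normrM normfV (gtr0_norm D0).
  by rewrite ler_pdivrMr.
apply: (@le_trans _ _ (2 * (M2 + C * M1) / c * rate h n * (c / 2 * h n))).
  by rewrite le_eqVlt; apply/orP; left; apply/eqP; field; rewrite gt_eqF.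
rewrite ler_wpM2l// mulr_ge0 ?rate_ge0// divr_ge0// ?ltW//.
by rewrite mulr_gt0// addr_gt0// mulr_gt0.
Unshelve. all: by end_near.
Qed.

End smoother_deviation.

(** * Expansion of the population bias *)

Section clamp.
Context (R : realType).
Implicit Types (p q u v : R) (a : R -> R).

(** Composing with the projection onto a compact subinterval extends a function on
    the open unit interval to a globally regular one. *)
Definition clamp p q u : R := Num.min (Num.max u p) q.

Lemma clamp_itv p q u : p <= q -> clamp p q u \in `[p, q].
Proof. by move=> pq; rewrite in_itv/= /clamp le_min le_max lexx orbT pq ge_min lexx orbT. Qed.

Lemma clamp_id p q u : u \in `[p, q] -> clamp p q u = u.
Proof. by rewrite in_itv/= => /andP[pu uq]; rewrite /clamp max_l// min_l. Qed.

Lemma clamp_lipschitz p q u v : `|clamp p q u - clamp p q v| <= `|u - v|.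
Proof.
rewrite /clamp /Num.min /Num.max.
by do 6?case: ifPn; rewrite -?leNgt => *; rewrite ler_norml; have := ler_norm (u - v);
  have := ler_norm (v - u); rewrite [`|v - u|]distrC; lra.
Qed.

Lemma clamp_continuous p q : continuous (clamp p q).
Proof.
apply: (lipschitz_continuous ltr01) => u v.
by rewrite mul1r clamp_lipschitz.
Qed.

Lemma continuous_clamp_comp p q a : 0 < p -> p <= q -> q < 1 ->
  {in `]0, 1[, forall x : R, derivable a x 1} -> continuous (a \o clamp p q).
Proof.
move=> p0 pq q1 da u; apply: continuous_comp; first exact: clamp_continuous.
apply: differentiable_continuous; apply/derivable1_diffP; apply: da.
have := clamp_itv u pq; rewrite !in_itv/=; lra.
Qed.

End clamp.

Section population_bias.
Context (R : realType) (K f : R -> R).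
Notation mu := (@lebesgue_measure R).
Hypotheses (kernelK : kernel_function K) (mf : measurable_fun setT f).

(** The kernel is supported on [-1, 1], so that [alpha n] may be replaced by its
    extension through [clamp], which is measurable on the line. *)
Lemma nw_bias_local (h x : R) (a b : R -> R) : 0 < h ->
  (forall u, `|u - x| <= h -> a u = b u) ->
  nw_bias K f h a x = nw_bias K f h b x.
Proof.
move=> h0 ab; rewrite /nw_bias; congr (_ / _); apply: eq_Rintegral => u _.
have [uh|uh] := leP `|u - x| h; last by rewrite (rescaled_kernel_out kernelK)// !mul0r.
by rewrite ab// ab// subrr normr0 ltW.
Qed.

Lemma derivable_expansion (x w : R) : derivable f x 1 -> 0 < w ->
  exists2 del, 0 < del & forall u, `|u - x| <= del ->
    `|f u - f x - f^`()%classic x * (u - x)| <= w * `|u - x|.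
Proof.
move=> df w0.
have /cvgrPdist_le /(_ _ w0) : h^-1 *: (f (h *: 1 + x) - f x) @[h --> 0^'] --> f^`()%classic x.
  by rewrite derive1E; exact: df.
rewrite near_withinE => -[r /= r0 Hr].
exists (r / 2); first by rewrite divr_gt0.
move=> u ur; have [->|ux] := eqVneq u x; first by rewrite !subrr mulr0 subrr normr0 mulr0.
have s0 : u - x != 0 by rewrite subr_eq0.
have ux_r : ball_ Num.norm 0 r (u - x).
  rewrite /ball_/= sub0r normrN (le_lt_trans ur)//.
  by rewrite ltr_pdivrMr// ltr_pMr// ltr1n.
have := Hr _ ux_r s0; rewrite /GRing.scale/= mulr1 subrK => H.
rewrite -ler_pdivrMr ?normr_gt0// -normfV -normrM.
rewrite (_ : _ * _ = - (f^`()%classic x - (u - x)^-1 * (f u - f x))) ?normrN//.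
by field.
Qed.

Lemma ratio_approx (N D q phi h e' B e : R) :
  0 < phi -> 0 < h -> `|N - q * h ^+ 3| <= e' * h ^+ 3 ->
  `|D - phi * h| <= e' * h -> `|q| <= B -> e' <= phi / 2 ->
  e' * (2 * (phi + B)) <= e * phi ^+ 2 ->
  `|- (N / D) / h ^+ 2 + q / phi| <= e.
Proof.
move=> phi0 h0 Nq Dphi qB ephi ee.
have D2 : phi / 2 * h <= D.
  have : e' * h <= phi / 2 * h by rewrite ler_pM2r.
  by move: Dphi; rewrite ler_distl => /andP[+ _]; lra.
have ph : 0 < phi / 2 * h by rewrite mulr_gt0// divr_gt0.
have D0 : 0 < D by exact: lt_le_trans D2.
have den0 : 0 < D * h ^+ 2 * phi by rewrite !mulr_gt0// exprn_gt0.
rewrite (_ : _ + _ = - ((N - q * h ^+ 3) * phi - q * h ^+ 2 * (D - phi * h)) /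
   (D * h ^+ 2 * phi)); last by field; rewrite !gt_eqF.
rewrite normrM normfV (gtr0_norm den0) normrN ler_pdivrMr//.
have h2 : 0 < h ^+ 2 by rewrite exprn_gt0.
have h3 : 0 < h ^+ 3 by rewrite exprn_gt0.
apply: (@le_trans _ _ (e' * h ^+ 3 * phi + B * h ^+ 2 * (e' * h))).
  rewrite (le_trans (ler_normB _ _))// lerD// normrM.
    by rewrite (gtr0_norm phi0) ler_pM2r.
  by rewrite ler_pM// normrM (gtr0_norm h2) ler_pM2r.
have e0 : 0 <= e.
  have e'0 : 0 <= e' by rewrite -(pmulr_lge0 _ h0); exact: le_trans Dphi.
  have B0 : 0 <= B by exact: le_trans qB.
  rewrite -(pmulr_lge0 _ (exprn_gt0 2 phi0)); apply: le_trans ee.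
  by rewrite mulr_ge0// mulr_ge0// addr_ge0// ltW.
apply: (@le_trans _ _ (e * (phi / 2 * h * h ^+ 2 * phi))); last first.
  by rewrite ler_wpM2l// ler_pM2r// ler_pM2r.
rewrite (_ : _ + _ = e' * (2 * (phi + B)) * (h ^+ 3 / 2)); last by field.
rewrite (_ : e * _ = e * phi ^+ 2 * (h ^+ 3 / 2)); last by field.
by rewrite ler_pM2r// divr_gt0.
Qed.

(** The remainder is split as (error of [Delta]) [r] + a1 s (error of [r])
    + a2 / 2 s^2 (r - phi), the last factor being O(s). *)
Lemma product_expansion (s Delta r phi f1 a1 a2 w C1 C2 h : R) :
  0 < phi -> `|Delta - a1 * s - a2 / 2 * s ^+ 2| <= w * s ^+ 2 ->
  `|r - phi - f1 * s| <= w * `|s| -> `|a1| <= C1 -> `|a2| <= C2 ->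
  `|s| <= h -> h <= w -> w <= 1 ->
  `|Delta * r - (a1 * phi * s + (a2 / 2 * phi + a1 * f1) * s ^+ 2)| <=
  w * (phi + `|f1| + 1 + C1 + C2 * (`|f1| + 1)) * h ^+ 2.
Proof.
move=> phi0 HD Hr Ha1 Ha2 sh hw w1.
have sw : `|s| <= w by exact: le_trans hw.
have s1 : `|s| <= 1 by exact: le_trans w1.
have w0 : 0 <= w by exact: le_trans sw.
have C20 : 0 <= C2 by exact: le_trans Ha2.
have C10 : 0 <= C1 by exact: le_trans Ha1.
have rphi : `|r - phi| <= (`|f1| + 1) * `|s|.
  rewrite -[r - phi](subrK (f1 * s)) (le_trans (ler_normD _ _))//.
  rewrite addrC mulrDl normrM lerD2l (le_trans Hr)//.
  by rewrite mul1r ler_piMl.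
have rb : `|r| <= phi + `|f1| + 1.
  rewrite -[r](subrK phi) (le_trans (ler_normD _ _))// (gtr0_norm phi0) addrC.
  rewrite -addrA lerD2l (le_trans rphi)//.
  by rewrite ler_piMr// addr_ge0.
rewrite (_ : _ - _ = (Delta - a1 * s - a2 / 2 * s ^+ 2) * r + a1 * s * (r - phi - f1 * s)
   + a2 / 2 * s ^+ 2 * (r - phi)); last by ring.
have s2 : s ^+ 2 = `|s| * `|s| by rewrite -expr2 real_normK ?num_real.
apply: (@le_trans _ _ (w * s ^+ 2 * (phi + `|f1| + 1) + C1 * `|s| * (w * `|s|) +
   C2 * s ^+ 2 * (w * (`|f1| + 1)))).
  rewrite (le_trans (ler_normD _ _))// lerD//.
    rewrite (le_trans (ler_normD _ _))// lerD// normrM; first exact: ler_pM.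
    by apply: ler_pM => //; rewrite normrM ler_wpM2r.
  rewrite normrM; apply: ler_pM => //.
    rewrite normrM [X in _ * X]ger0_norm ?sqr_ge0// ler_wpM2r ?sqr_ge0//.
    rewrite normrM normfV [X in _ / X]ger0_norm// ler_pdivrMr// (le_trans Ha2)//.
    by rewrite ler_peMr// ler1n.
  by rewrite (le_trans rphi)// mulrC ler_wpM2r// addr_ge0.
rewrite (_ : _ + _ + _ = w * (phi + `|f1| + 1 + C1 + C2 * (`|f1| + 1)) * s ^+ 2); last first.
  by rewrite s2; ring.
rewrite ler_wpM2l//.
  by rewrite mulr_ge0// !addr_ge0 ?mulr_ge0 ?addr_ge0// ltW.
by rewrite s2 expr2 ler_pM.
Qed.

(** The linear term a1 phi s of the expansion of (alpha(u) - alpha(x)) f(u)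
    integrates to zero, which leaves Q h^3 int u^2 K with
    Q = a2 phi / 2 + a1 f'(x); the denominator is phi h up to o(h).  Both
    errors are relative o(1) uniformly in n because alpha_n' and alpha_n'' are
    bounded and alpha_n'' is equicontinuous. *)
Lemma nw_bias_asymptotics (h : nat -> R) (alpha : nat -> R -> R) (x : R) :
  (forall n, 0 < h n) -> h n @[n --> \oo] --> 0 ->
  (forall n, {in `]0, 1[, forall y : R,
     derivable (alpha n) y 1 /\ derivable (alpha n)^`()%classic y 1}) ->
  (forall k, (k <= 2)%N ->
     asymptotically_equicontinuous `]0, 1[ (fun n => (alpha n)^`(k)%classic)) ->
  x \in `]0, 1[ -> derivable f x 1 -> 0 < f x ->
  - nw_bias K f (h n) (alpha n) x / h n ^+ 2
  - (- (1 / 2) * (((alpha n)^`(2)%classic x * f x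
        + 2 * (alpha n)^`()%classic x * f^`()%classic x) / f x)
      * \int[mu]_u (u ^+ 2 * K u)) @[n --> \oo] --> 0.
Proof.
move=> h_gt0 h_cvg0 dalpha ealpha x01 dfx fx0.
have [C1 C10 near1] := derive_bounded_near (ealpha 0%N isT) (ealpha 1%N isT)
  (fun n y y01 => (dalpha n y y01).1).
have [C2 C20 near2] := derive_bounded_near (ealpha 1%N isT) (ealpha 2%N isT)
  (fun n y y01 => (dalpha n y y01).2).
set s2 := \int[mu]_u (u ^+ 2 * K u).
pose phi : R := f x; pose f1 : R := f^`()%classic x.
have phi0 : 0 < phi by [].
pose A := phi + `|f1| + 1 + C1 + C2 * (`|f1| + 1).
have f11 : 0 < `|f1| + 1 by rewrite ltr_wpDl.
have C2f1 : 0 <= C2 * (`|f1| + 1) by rewrite mulr_ge0// ltW.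
have f1A : `|f1| + 1 <= A by rewrite /A; lra.
have A0 : 0 < A by exact: lt_le_trans f1A.
pose B := (C2 / 2 * phi + C1 * `|f1|) * `|s2|.
have B0 : 0 <= B.
  by rewrite /B mulr_ge0// addr_ge0 ?mulr_ge0 ?divr_ge0// ltW.
apply/cvgr0Pnorm_le => e e0.
(* the tolerance [ratio_approx] needs to reach [e], then the oscillation [w]
   that keeps the error of [product_expansion] below it *)
pose e' := Num.min (phi / 2) (e * phi ^+ 2 / (2 * (phi + B))).
have pB : 0 < phi + B by rewrite ltr_wpDr.
have e'0 : 0 < e'.
  by rewrite lt_min !divr_gt0// ?mulr_gt0// exprn_gt0.
pose w := Num.min 1 (e' / A).
have w0 : 0 < w by rewrite lt_min ltr01 divr_gt0.
have w1 : w <= 1 by rewrite ge_min lexx.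
have wA : w * A <= e' by rewrite -ler_pdivlMr// /w ge_min lexx orbT.
have [d1 d10 Hf] := derivable_expansion dfx w0.
have [d2 d20 nearw] := equicontinuous_near (ealpha 2%N isT) w0.
pose p := x / 2; pose q := (1 + x) / 2.
have [p0 px xq q1] : [/\ 0 < p, p < x, x < q & q < 1].
  by move: x01; rewrite in_itv/= /p /q; split; lra.
near=> n.
have hn := h_gt0 n.
have hw : h n <= w by near: n; exact: near_bandwidth_le.
have hd1 : h n <= d1 by near: n; exact: near_bandwidth_le.
have hd2 : h n <= d2 by near: n; exact: near_bandwidth_le.
have hp : h n <= x - p by near: n; apply: near_bandwidth_le => //; rewrite subr_gt0.
have hq : h n <= q - x by near: n; apply: near_bandwidth_le => //; rewrite subr_gt0.
have upq u : `|u - x| <= h n -> u \in `[p, q].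
  by rewrite ler_distl in_itv/=; lra.
have u01 u : u \in `[p, q] -> u \in `]0, 1[ by rewrite !in_itv/=; lra.
pose a := alpha n \o clamp p q.
have pq : p <= q by lra.
have ca : continuous a.
  by apply: continuous_clamp_comp => // y y01; exact: (dalpha n y y01).1.
rewrite (@nw_bias_local (h n) x (alpha n) a)//; last first.
  by move=> u /upq upq'; rewrite /a/= clamp_id.
pose a1 : R := (alpha n)^`()%classic x; pose a2 : R := (alpha n)^`(2)%classic x.
have Ha1 : `|a1| <= C1.
  suff H : forall u : R, u \in `]0, 1[ -> `|(alpha n)^`()%classic u| <= C1 by exact: H.
  by near: n; exact: near1.
have Ha2 : `|a2| <= C2.
  suff H : forall u : R, u \in `]0, 1[ -> `|(alpha n)^`(2)%classic u| <= C2 by exact: H.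
  by near: n; exact: near2.
have Hw : forall u v, u \in `]0, 1[ -> v \in `]0, 1[ -> `|u - v| <= d2 ->
  `|(alpha n)^`(2)%classic u - (alpha n)^`(2)%classic v| <= w by near: n.
have ax : a x = alpha n x by rewrite /a/= clamp_id// upq// subrr normr0 ltW.
pose Q := a2 / 2 * phi + a1 * f1.
have mpsi : measurable_fun setT (fun u => (a u - a x) * f u).
  apply: measurable_funM => //; apply: measurable_funB => //.
  exact: continuous_measurable_fun.
have [|_ HN] := @kernel_integral_approx _ _ kernelK _ x (h n)
    0 (a1 * phi) Q (w * A * h n ^+ 2) hn mpsi.
  move=> u uh; rewrite add0r; apply: product_expansion => //.
  - rewrite ax /a/= clamp_id ?upq//; apply: taylor2_01 => //.
      exact/u01/upq.
    move=> v v01 vu; apply: Hw => //.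
    exact: le_trans vu (le_trans uh hd2).
  - by apply: Hf; exact: le_trans hd1.
have [|_ HD] := @kernel_integral_approx _ _ kernelK f x (h n) phi 0 0 (w * A) hn mf.
  move=> u uh; rewrite !mul0r !addr0.
  have := Hf u (le_trans uh hd1); rewrite -/phi -/f1 => Hfu.
  rewrite -[f u - phi](subrK (f1 * (u - x))) (le_trans (ler_normD _ _))//.
  apply: (@le_trans _ _ (w * (`|f1| + 1))); last by rewrite ler_pM2l.
  have uw : `|u - x| <= w by exact: le_trans hw.
  rewrite [leRHS]mulrDr mulr1 [leRHS]addrC lerD//.
    by rewrite (le_trans Hfu)// ler_piMr ?(ltW w0)// (le_trans uw).
  by rewrite normrM mulrC ler_wpM2r.
rewrite /nw_bias.
set N := \int[mu]_u _ in HN *; set D := \int[mu]_u _ in HD *.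
rewrite [X in `|X|](_ : _ = - (N / D) / h n ^+ 2 + Q * s2 / phi); last first.
  congr (_ + _); rewrite -[(alpha n)^`(2)%classic x]/a2 -[(alpha n)^`()%classic x]/a1.
  by rewrite -[f x]/phi -[f^`()%classic x]/f1 /Q; field; rewrite gt_eqF.
apply: (@ratio_approx _ _ _ _ _ (w * A) B) => //.
- move: HN; rewrite mul0r add0r mulrAC -/s2; rewrite -[w * A * _ * _]mulrA -exprSr => HN.
  by move: HN; rewrite mulrAC.
- by move: HD; rewrite !mul0r addr0.
- rewrite normrM /B ler_wpM2r// (le_trans (ler_normD _ _))// lerD// normrM.
    rewrite (gtr0_norm fx0) ler_pM2r// normrM normfV [X in _ / X]ger0_norm//.
    by rewrite ler_pM2r ?invr_gt0.
  by rewrite ler_wpM2r.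
- by rewrite (le_trans wA)// /e' ge_min lexx.
- rewrite -ler_pdivlMr ?mulr_gt0//; apply: le_trans wA _.
  by rewrite /e' ge_min lexx orbT.
Unshelve. all: by end_near.
Qed.

End population_bias.

(** * One step of boosting *)

Section boosting.
Context (R : realType) (K : R -> R) (h : R) (n : nat) (t : 'I_n -> R) (x : R).
Hypotheses (kernelK : kernel_function K) (h_gt0 : 0 < h).

Lemma nw_weight_ge0 i : 0 <= nw_weight K h t i x.
Proof.
rewrite /nw_weight /rescaled divr_ge0//.
  by rewrite divr_ge0 ?(ltW h_gt0)// (kernel_ge0 kernelK).
by apply: sumr_ge0 => k _; rewrite divr_ge0 ?(ltW h_gt0)// (kernel_ge0 kernelK).
Qed.

Lemma sum_nw_weight_le1 : \sum_(i < n) nw_weight K h t i x <= 1.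
Proof.
rewrite -mulr_suml; set s := \sum_(i < n) _.
by have [->|s0] := eqVneq s 0; [rewrite mul0r|rewrite divff].
Qed.

Lemma nw_weight_support i : nw_weight K h t i x != 0 -> `|t i - x| <= h.
Proof.
apply: contraNT; rewrite -ltNge => hti.
by rewrite /nw_weight /rescaled (rescaled_kernel_out kernelK)// !mul0r.
Qed.

(** Since the weights of the pre-estimate at X_i sum to one, its bias can be
    recentred: sum_j wt_j(X_i) (m(X_j) - m(x)) is the bias at X_i plus
    m(X_i) - m(x), and the second part cancels the bias of the
    Nadaraya-Watson smoother itself. *)
Lemma cond_bias_boosted (m : R -> R) (wt : 'I_n -> R -> R) :
  (forall i, nw_weight K h t i x != 0 -> \sum_(j < n) wt j (t i) = 1) ->
  cond_bias m t (boosted_weight K h t wt) x =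
  cond_bias m t wt x - \sum_(i < n) nw_weight K h t i x * cond_bias m t wt (t i).
Proof.
move=> wt1; rewrite /cond_bias /boosted_weight.
under eq_bigr do rewrite mulrBl mulrDl mulr_suml.
rewrite sumrB big_split/= [X in _ - X = _]exchange_big/=.
rewrite [X in X - _]addrC -addrA; congr (_ + _).
rewrite -sumrB -sumrN; apply: eq_bigr => i _.
have [->|Wi] := eqVneq (nw_weight K h t i x) 0.
  by rewrite !mul0r big1 ?subrr ?oppr0// => j _; rewrite !mul0r.
rewrite -[LHS]opprB; congr (- _).
under eq_bigr do rewrite -mulrA.
rewrite -mulr_sumr -mulrBr; congr (_ * _).
rewrite -[X in _ - X]mul1r -(wt1 i Wi) mulr_suml -sumrB.
by apply: eq_bigr => j _; ring.
Qed.

End boosting.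

Theorem theorem2 (d : measure_display) (T : measurableType d) (R : realType)
  (P : probability T R)
  (X Y : {RV P >-> R}) (Xs Ys : nat -> {RV P >-> R})
  (f m K : R -> R) (h : nat -> R)
  (wt : forall n, ('I_n -> R) -> 'I_n -> R -> R)
  (r : nat) (alpha : nat -> R -> R)
  (iid : iid_copies Xs Ys X Y)
  (density_f : has_density X f)
  (supp_f : forall x : R, x \notin `[0, 1] -> f x = 0)
  (reg_m : regression_function X Y m)
  (kernel_K : kernel_function K)
  (h_gt0 : forall n, 0 < h n)
  (h_cvg0 : h n @[n --> \oo] --> 0)
  (nh_cvgy : n%:R * h n / ln n%:R @[n --> \oo] --> +oo)
  (diff_f : {in `]0, 1[, forall x : R, derivable f x 1})
  (cont_f' : {in `]0, 1[, continuous f^`()%classic})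
  (inf_f : 0 < inf [set f x | x in `[0, 1]])
  (wt_sum1 : forall n, (0 < n)%N ->
     {ae P, forall w, forall x : R, x \in `[0, 1] ->
        \sum_(j < n) wt n (design Xs w) j x = 1})
  (r_ge1 : (1 <= r)%N)
  (bias_wt : bigO_p_interior P
     (fun n w x => cond_bias m (design Xs w) (wt n (design Xs w)) x
                   - h n ^+ (2 * r) * alpha n x)
     (fun n => Num.sqrt (h n * ln n%:R / n%:R)))
  (diff_alpha : forall n, {in `]0, 1[, forall x : R,
     derivable (alpha n) x 1 /\ derivable (alpha n)^`()%classic x 1})
  (equicont_alpha : forall k, (k <= 2)%N ->
     asymptotically_equicontinuous `]0, 1[ (fun n => (alpha n)^`(k)%classic)) :
  exists2 beta : nat -> R -> R,
    bigO_p_interior P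
      (fun n w x =>
         cond_bias m (design Xs w)
           (boosted_weight K (h n) (design Xs w) (wt n (design Xs w))) x
         - h n ^+ (2 * r.+1) * beta n x)
      (fun n => Num.sqrt (h n * ln n%:R / n%:R))
  & {in `]0, 1[, forall x : R,
      beta n x
      - (- (1 / 2)
         * (((alpha n)^`(2)%classic x * f x
             + 2 * (alpha n)^`()%classic x * f^`()%classic x) / f x)
         * \int[lebesgue_measure]_u (u ^+ 2 * K u))
      @[n --> \oo] --> 0}.
Proof.
have [indX fX] := iid_marginal iid density_f.
have [mf f0 _] := density_f.
set c := inf _ in inf_f.
have cf u : u \in `[0, 1] -> c <= f u.
  move=> u01; apply: ge_inf; last by exists u.
  by exists 0 => _ [v _ <-].
exists (fun n x => - nw_bias K f (h n) (alpha n) x / h n ^+ 2); last first.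
  move=> x x01; apply: nw_bias_asymptotics => //; first exact: diff_f.
  by apply: lt_le_trans inf_f _; apply: cf; move: x01; rewrite !in_itv/=; lra.
have [C C0 nearC] := derive_bounded_near (equicont_alpha 0%N isT)
  (equicont_alpha 1%N isT) (fun n y y01 => (diff_alpha n y y01).1).
have [e0 e00 bias_e0] : exists2 e0, 0 < e0 & forall e, 0 < e -> e < e0 ->
    bigO_p P (fun n w => ereal_sup
      [set `|cond_bias m (design Xs w) (wt n (design Xs w)) x
             - h n ^+ (2 * r) * alpha n x|%:E | x in `[e, 1 - e]]) (rate h).
  have := bias_wt; rewrite /bigO_p_interior near_withinE => -[e0 /= e00 He0].
  exists e0 => // e e_gt0 ee0; apply: He0 => //=.
  by rewrite /ball_/= sub0r normrN gtr0_norm.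
near=> eps.
(* the design points with nonzero weight lie within h of the interval for eps,
   hence in the interval for eps / 2 *)
have eps0 : 0 < eps by near: eps; exact: nbhs_right_gt.
have eps2 : eps < 1 / 2 by near: eps; apply: nbhs_right_lt; lra.
have epse0 : eps / 2 < e0.
  have : eps < e0 by near: eps; exact: nbhs_right_lt.
  lra.
have O1 : bigO_p P (fun n w => ereal_sup
      [set `|cond_bias m (design Xs w) (wt n (design Xs w)) x
             - h n ^+ (2 * r) * alpha n x|%:E | x in `[eps / 2, 1 - eps / 2]]) (rate h).
  by apply: bias_e0 => //; rewrite divr_gt0.
pose a n := alpha n \o clamp (eps / 2) (1 - eps / 2).
have cl01 u : clamp (eps / 2) (1 - eps / 2) u \in `]0, 1[.
  have : eps / 2 <= 1 - eps / 2 by lra.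
  by move=> /(clamp_itv u); rewrite !in_itv/=; lra.
have near_aC : \forall n \near \oo, forall u v, `|a n u - a n v| <= C * `|u - v|.
  near=> n => u v.
  have dC : forall u : R, u \in `]0, 1[ -> `|(alpha n)^`()%classic u| <= C.
    by near: n; exact: nearC.
  have [|z [z01 _ E]] := @mean_value_01 _ (alpha n) (alpha n)^`()%classic
    _ _ (cl01 v) (cl01 u).
    move=> y y01; rewrite derive1E; apply: DeriveDef => //.
    exact: (diff_alpha n y y01).1.
  rewrite /a/= E normrM ler_pM ?dC//.
  exact: clamp_lipschitz.
have [z _ fz] : exists2 z, z \in `[eps / 2, 1 - eps / 2] &
    forall u, u \in `[eps / 2, 1 - eps / 2] -> f u <= f z.
  apply: EVT_max; first lra.
  apply: derivable_within_continuous => u ueps; apply: diff_f.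
  by move: ueps; rewrite !in_itv/=; lra.
have fcF u : u \in `[eps - eps / 2, 1 - eps + eps / 2] -> c <= f u <= f z.
  move=> ueps; have ueps' : u \in `[eps / 2, 1 - eps / 2].
    by move: ueps; rewrite !in_itv/=; lra.
  rewrite fz// andbT; apply: cf; move: ueps'; rewrite !in_itv/=; lra.
have [e1 e1le] : eps <= 1 - eps /\ (1 - eps) - eps <= 1 by lra.
have e20 : 0 < eps / 2 by rewrite divr_gt0.
have O2 := nw_smoother_deviation indX fX kernel_K h_gt0 h_cvg0 nh_cvgy
  e1 e1le e20 inf_f C0 fcF near_aC.
apply: (bigO_p_combine (a := rate h)
  (Q := fun n w => forall x : R, x \in `[0, 1] -> \sum_(j < n) wt n (design Xs w) j x = 1)
  O1 O2).
  by near=> n; apply: wt_sum1; near: n; exact: nbhs_infty_gt.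
move=> M1 M2 M10 M20; exists (2 * M1 + M2); first by rewrite addr_gt0// mulr_gt0.
near=> n => w wt1 Z1 Z2.
apply: ge_ereal_sup => _ [x xeps <-]; rewrite lee_fin.
have {}xeps : x \in `[eps, 1 - eps] by [].
have hn := h_gt0 n.
have heps : h n <= eps / 2 by near: n; exact: near_bandwidth_le.
have h1 : h n <= 1 by near: n; exact: near_bandwidth_le.
have near_x u : `|u - x| <= h n -> u \in `[eps / 2, 1 - eps / 2].
  by move: xeps; rewrite ler_distl !in_itv/=; lra.
set t := @design _ _ _ P Xs n w.
pose W i := nw_weight K (h n) t i x.
pose B y := cond_bias m t (wt n t) y.
pose rho y := B y - h n ^+ (2 * r) * alpha n y.
have rho_le y : y \in `[eps / 2, 1 - eps / 2] -> `|rho y| <= M1 * rate h n.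
  move=> yeps; rewrite -lee_fin; apply: le_trans Z1.
  by apply: ereal_sup_ubound; exists y.
have {Z2} : `|\sum_(i < n) W i * a n (t i) - a n x - nw_bias K f (h n) (a n) x|
    <= M2 * rate h n.
  by rewrite -lee_fin; apply: le_trans Z2; apply: ereal_sup_ubound; exists x.
have a_alpha u : `|u - x| <= h n -> a n u = alpha n u.
  by move=> /near_x ueps; rewrite /a/= clamp_id.
rewrite (nw_bias_local f kernel_K hn a_alpha) a_alpha ?subrr ?normr0 ?(ltW hn)//.
have -> : \sum_(i < n) W i * a n (t i) = \sum_(i < n) W i * alpha n (t i).
  apply: eq_bigr => i _; have [->|Wi] := eqVneq (W i) 0; first by rewrite !mul0r.
  by rewrite a_alpha//; exact: nw_weight_support Wi.
set b := nw_bias _ _ _ _ _ => dev.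
rewrite cond_bias_boosted; last first.
  move=> i /(nw_weight_support kernel_K hn) /near_x tieps; apply: wt1.
  by move: tieps; rewrite !in_itv/=; lra.
rewrite -/(B x) (_ : _ - _ = rho x - \sum_(i < n) W i * rho (t i)
  - h n ^+ (2 * r) * (\sum_(i < n) W i * alpha n (t i) - alpha n x - b)); last first.
  have -> : \sum_(i < n) W i * rho (t i) = \sum_(i < n) W i * B (t i)
     - h n ^+ (2 * r) * \sum_(i < n) W i * alpha n (t i).
    by rewrite mulr_sumr -sumrB; apply: eq_bigr => i _; rewrite /rho; ring.
  rewrite mulnS addnC exprD /rho.
  by field; rewrite gt_eqF.
have hr1 : h n ^+ (2 * r) <= 1 by rewrite exprn_ile1// ltW.
have r0 := rate_ge0 h n.
have sum_rho : `|\sum_(i < n) W i * rho (t i)| <= M1 * rate h n.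
  apply: (@le_trans _ _ ((\sum_(i < n) W i) * (M1 * rate h n))); last first.
    by rewrite ler_piMl ?mulr_ge0 ?(ltW M10)// sum_nw_weight_le1.
  rewrite mulr_suml; apply: le_trans (ler_norm_sum _ _ _) _; apply: ler_sum => i _.
  rewrite normrM (ger0_norm (nw_weight_ge0 t x kernel_K hn i)) -/(W i).
  have [->|Wi] := eqVneq (W i) 0; first by rewrite !mul0r.
  rewrite ler_wpM2l ?(nw_weight_ge0 _ _ kernel_K)//; apply/rho_le/near_x.
  exact: nw_weight_support Wi.
have rx : `|rho x| <= M1 * rate h n.
  by apply/rho_le/near_x; rewrite subrr normr0 ltW.
rewrite (le_trans (ler_normB _ _))// mulrDl lerD//.
  by rewrite (le_trans (ler_normB _ _))// -mulrA mulr2n mulrDl mul1r lerD.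
rewrite normrM (ger0_norm (exprn_ge0 _ (ltW hn))) -[leRHS]mul1r.
by rewrite ler_pM ?exprn_ge0// ltW.
Unshelve. all: by end_near. Qed.
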